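(* Let $l\ge2$. The action of the extended affine Weyl group $\widetilde W=\langle s_0,\ldots,s_l,\pi\rangle$ on $\mathbb{C}(\alpha;f;\tau)$ commutes with the derivation of the differential field $\mathbb{C}(\alpha;f;\tau)$; that is, $w(\varphi')=w(\varphi)'$ for all $w\in\widetilde W$ and $\varphi\in\mathbb{C}(\alpha;f;\tau)$.
   Context: Let $l\ge 2$ be an integer. All indices $0,1,\ldots,l$ are understood as elements of $\mathbb{Z}/(l+1)\mathbb{Z}$. $\mathbb{C}(\alpha;f)$ is the field of rational functions in the independent variables $\alpha=(\alpha_0,\ldots,\alpha_l)$ and $f=(f_0,\ldots,f_l)$; put $k=\alpha_0+\cdots+\alpha_l$. Derivation on $\mathbb{C}(\alpha;f)$: $'$ is the $\mathbb{C}$-linear derivation with $\alpha_j'=0$ and, if $l=2n$ ($n\ge1$), $$f_j'=f_j\Big(\sum_{1\le r\le n}f_{j+2r-1}-\sum_{1\le r\le n}f_{j+2r}\Big)+\alpha_j;$$ if $l=2n+1$ ($n\ge1$), $$f_j'=f_j\Big(\sum_{1\le r\le s\le n}f_{j+2r-1}f_{j+2s}-\sum_{1\le r\le s\le n}f_{j+2r}f_{j+2s+1}\Big)+\Big(\frac{k}{2}-\sum_{1\le r\le n}\alpha_{j+2r}\Big)f_j+\alpha_j\Big(\sum_{1\le r\le n}f_{j+2r}\Big).$$ Action on $\mathbb{C}(\alpha;f)$: $s_i$ ($i=0,\ldots,l$) is the $\mathbb{C}$-automorphism with $s_i(\alpha_i)=-\alpha_i$, $s_i(\alpha_j)=\alpha_j+\alpha_i$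 for $j=i\pm1$, $s_i(\alpha_j)=\alpha_j$ for $j\ne i,i\pm1$; $s_i(f_i)=f_i$, $s_i(f_{i+1})=f_{i+1}+\alpha_i/f_i$, $s_i(f_{i-1})=f_{i-1}-\alpha_i/f_i$, $s_i(f_j)=f_j$ for $j\neq i,i\pm1$. $\pi$ is the $\mathbb{C}$-automorphism with $\pi(\alpha_j)=\alpha_{j+1}$, $\pi(f_j)=f_{j+1}$. Hamiltonians: for $1\le i\le l$ put $\varpi_i=\sum_{r=1}^l\big(\min\{i,r\}-\frac{ir}{l+1}\big)\alpha_r$, and $\varpi_0=0$ (indices of $\varpi$ modulo $l+1$). Let $\Gamma$ be the cycle graph with nodes $\mathbb{Z}/(l+1)\mathbb{Z}$. For a chain $C=\{j,j+1,\ldots,j+m-1\}$ of consecutive nodes ($m\le l$) put $\chi(C)=\varpi_j-\varpi_{j+1}+\cdots+(-1)^{m-1}\varpi_{j+m-1}$; for a subdiagram $C\ne\Gamma$ let $\chi(C)$ be the sum of $\chi(C_i)$ over its connected components $C_i$ (so $\chi(\emptyset)=0$). For $1\le d\le l+1$ let $\mathcal{S}_d$ be the set of subsets $K\subset\{0,\ldots,l\}$ with $|K|=d$ such that all connected components of $K^{c}=\Gamma\setminus K$ are chains with an even number of nodes, and put $f_K=\prod_{i\in K}f_i$. Define $$h_0=\sum_{K\in\mathcal{S}_3}f_K+\sum_{K\in\mathcal{S}_1}\chi(K^{c})f_K\quad(l=2n),$$ $$h_0=\sum_{K\in\mathcal{S}_4}f_K+\sum_{K\in\mathcal{S}_2}\chi(K^{c})f_K+\Big(\sum_{i=1}^{2n+1}(-1)^{i-1}\varpi_i\Big)^2\quad(l=2n+1),$$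 and $h_i=\pi(h_{i-1})$ for $i=1,\ldots,l$. $\tau$-functions: $\mathbb{C}(\alpha;f;\tau)$ is the field of rational functions in independent variables $\tau_0,\ldots,\tau_l$ over $\mathbb{C}(\alpha;f)$, with the derivation extended by $k\,\tau_j'=h_j\tau_j$ ($j=0,\ldots,l$). The automorphisms $s_i$, $\pi$ are extended to $\mathbb{C}(\alpha;f;\tau)$ by $$s_i(\tau_j)=\tau_j\ (i\ne j),\qquad s_j(\tau_j)=\frac{\tau_{j-1}\tau_{j+1}}{\tau_j}f_j,\qquad \pi(\tau_j)=\tau_{j+1}.$$ It is known that these extended automorphisms define a representation of the extended affine Weyl group $\widetilde W$ of type $A^{(1)}_l$. *)

(* Defs.v *)
From HB Require Import structures.
From mathcomp Require Import all_boot all_order all_algebra.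
From mathcomp Require Import generic_quotient fingraph.
From mathcomp Require Import mpoly.
From mathcomp Require Import ring zify.

Set Implicit Arguments.
Unset Strict Implicit.
Unset Printing Implicit Defensive.

Import GRing.Theory.
Local Open Scope ring_scope.
Local Open Scope quotient_scope.

Local Notation "x %:F" := (@FracField.tofrac _ x).

Lemma zmod_morphismD (U V : zmodType) (g : U -> V) :
  zmod_morphism g -> {morph g : x y / x + y}.
Proof.
move=> gB x y; have g0 : g 0 = 0 by rewrite -(subrr 0) gB subrr.
have gN z : g (- z) = - g z by rewrite -sub0r gB g0 sub0r.
by rewrite -{1}[y]opprK gB gN opprK.
Qed.

Section FieldFacts.
Variable L : fieldType.
Implicit Types a b c d p q r s : L.

Lemma subf_div a b c d : b != 0 -> d != 0 ->
  a / b - c / d = (a * d - c * b) / (b * d).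
Proof. by move=> *; field; apply/andP. Qed.

Lemma quotient_rule_wd p q r s p' q' r' s' : q != 0 -> s != 0 ->
  p * s = r * q -> p' * s + p * s' = r' * q + r * q' ->
  (p' * q - p * q') / q ^+ 2 = (r' * s - r * s') / s ^+ 2.
Proof.
move=> q0 s0 e e'; have -> : r = p * s / q by rewrite e mulfK.
have -> : r' = (p' * s + p * s' - p * s / q * q') / q.
  by rewrite e e' mulfK // addrK mulfK.
by field; apply/andP.
Qed.

Lemma quotient_ruleD p q r s p' q' r' s' : q != 0 -> s != 0 ->
  ((p' * s + p * s' + (r' * q + r * q')) * (q * s)
     - (p * s + r * q) * (q' * s + q * s')) / (q * s) ^+ 2
  = (p' * q - p * q') / q ^+ 2 + (r' * s - r * s') / s ^+ 2.
Proof. by move=> *; field; apply/andP. Qed.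

Lemma quotient_ruleM p q r s p' q' r' s' : q != 0 -> s != 0 ->
  ((p' * r + p * r') * (q * s) - p * r * (q' * s + q * s')) / (q * s) ^+ 2
  = (p' * q - p * q') / q ^+ 2 * (r / s)
    + p / q * ((r' * s - r * s') / s ^+ 2).
Proof. by move=> *; field; apply/andP. Qed.

Lemma swap_quotient a b c d : a != 0 -> b != 0 -> c != 0 -> d != 0 ->
  a = b * c / (b * c / a * d) * d.
Proof. by move=> *; field; apply/and4P. Qed.

End FieldFacts.

HB.lock Definition peval (K : fieldType) (n : nat)
    (v : 'I_n -> {fraction {mpoly K[n]}}) (p : {mpoly K[n]}) :
    {fraction {mpoly K[n]}} :=
  mmap (@FracField.tofrac _ \o @mpolyC n K) v p.

(* Rational functions in n variables: substitution and derivations.  Both are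
   computed on a representing pair (numerator, denominator); the lemmas below
   show independence of that choice (for substitutions: as soon as the
   substituted elements are algebraically independent). *)
Section RationalFunctions.
Context {K : fieldType} {n : nat}.
Local Notation P := {mpoly K[n]}.
Local Notation F := {fraction {mpoly K[n]}}.

Definition rcst (c : K) : F := (c%:MP)%:F.
Definition rvar (i : 'I_n) : F := ('X_i)%:F.

Definition rnum (x : F) : P := \n_(repr x).
Definition rden (x : F) : P := \d_(repr x).

(* the K-endomorphism sending the i-th variable to v i *)
Definition rsubst (v : 'I_n -> F) (x : F) : F :=
  peval v (rnum x) / peval v (rden x).

Definition pder (v : 'I_n -> F) (p : P) : F :=
  \sum_(i < n) (mderiv i p)%:F * v i.

(* the K-linear derivation sending the i-th variable to v i *)
Definition rder (v : 'I_n -> F) (x : F) : F :=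
  (pder v (rnum x) * (rden x)%:F - (rnum x)%:F * pder v (rden x))
    / (rden x)%:F ^+ 2.

Lemma rden_neq0 x : rden x != 0.
Proof. exact: denom_ratioP. Qed.

Lemma rnum_rden x : x = (rnum x)%:F / (rden x)%:F.
Proof.
have dF : (rden x)%:F != 0 :> F by rewrite tofrac_eq0 rden_neq0.
apply: (mulIf dF); rewrite divfK //.
have {1}-> : x = \pi_F (repr x) by rewrite reprK.
rewrite /rnum /rden; move: (repr x) => y.
rewrite -[_ * _]/(FracField.mul _ _); apply/eqP; rewrite !piE FracField.equivfE.
rewrite /FracField.mulf !numden_Ratio ?mulf_neq0 ?oner_neq0 ?denom_ratioP //.
by rewrite !mulr1 mulrC.
Qed.

Lemma rfracP (x : F) : exists p q : P, q != 0 /\ x = p%:F / q%:F.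
Proof. by exists (rnum x), (rden x); split; [apply: rden_neq0|apply: rnum_rden]. Qed.

Lemma rfrac_eq (p q p' q' : P) : q != 0 -> q' != 0 ->
  (p%:F / q%:F == p'%:F / q'%:F :> F) = (p * q' == p' * q).
Proof.
by move=> q0 q'0; rewrite eqr_div ?tofrac_eq0 // -!tofracM tofrac_eq.
Qed.

Section Peval.
Variable v : 'I_n -> F.

Lemma pevalB : {morph peval v : p q / p - q}. Proof. by rewrite unlock; exact: rmorphB. Qed.
Lemma pevalD : {morph peval v : p q / p + q}. Proof. by rewrite unlock; exact: rmorphD. Qed.
Lemma pevalM : {morph peval v : p q / p * q}. Proof. by rewrite unlock; exact: rmorphM. Qed.
Lemma pevalN : {morph peval v : p / - p}. Proof. by rewrite unlock; exact: rmorphN. Qed.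
Lemma peval0 : peval v 0 = 0. Proof. by rewrite unlock; exact: rmorph0. Qed.
Lemma peval1 : peval v 1 = 1. Proof. rewrite unlock; exact: rmorph1. Qed.

Lemma pevalC c : peval v c%:MP = rcst c.
Proof. by rewrite unlock; exact: mmapC. Qed.

Lemma pevalX i : peval v 'X_i = v i.
Proof. by rewrite unlock mmapX mmap1U. Qed.

End Peval.

Lemma pind (Q : P -> Prop) : (forall c, Q c%:MP) -> (forall i, Q 'X_i) ->
  (forall p q, Q p -> Q q -> Q (p + q)) ->
  (forall p q, Q p -> Q q -> Q (p * q)) -> forall p, Q p.
Proof.
move=> QC QX QD QM; elim/mpolyind => [|c m p _ _ Qp].
  by rewrite -mpolyC0; apply: QC.
apply: (QD) => //; rewrite -mul_mpolyC; apply: (QM) => //.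
rewrite mpolyXE_id; apply: (big_ind Q) => [||i _]; [|exact: QM|].
  by rewrite -mpolyC1; apply: QC.
elim: (m i) => [|k IH]; first by rewrite expr0 -mpolyC1; apply: QC.
by rewrite exprS; apply: QM.
Qed.

Lemma peval_id (p : P) : peval rvar p = p%:F.
Proof.
elim/pind: p => [c|i|p q|p q]; first by rewrite pevalC.
- by rewrite pevalX.
- by rewrite !(pevalD, tofracD) => -> ->.
- by rewrite !(pevalM, tofracM) => -> ->.
Qed.

Definition algindep (v : 'I_n -> F) := forall p, peval v p = 0 -> p = 0.

Section Subst.
Variable v : 'I_n -> F.
Hypothesis v_indep : algindep v.

Let pe0 q : q != 0 -> peval v q != 0.
Proof. by apply: contra_neq => /v_indep. Qed.

Lemma rsubst_frac (p q : P) : q != 0 ->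
  rsubst v (p%:F / q%:F) = peval v p / peval v q.
Proof.
move=> q0; rewrite /rsubst; set x := _ / q%:F.
have /eqP := rnum_rden x; rewrite {1}/x rfrac_eq ?rden_neq0 // => /eqP e.
apply/eqP; rewrite eqr_div ?pe0 ?rden_neq0 //.
by rewrite -!(pevalM, tofracM) e.
Qed.

Lemma rsubst_poly (p : P) : rsubst v p%:F = peval v p.
Proof. by rewrite -[p%:F]divr1 -tofrac1 rsubst_frac ?oner_neq0 // (peval1, tofrac1) divr1. Qed.

Lemma rsubst_zmod_morphism : zmod_morphism (rsubst v).
Proof.
move=> x y; have [p [q [q0 ->]]] := rfracP x; have [r [s [s0 ->]]] := rfracP y.
rewrite subf_div ?tofrac_eq0 // -!tofracM -tofracB !rsubst_frac ?mulf_neq0 //.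
by rewrite pevalB !pevalM subf_div ?pe0.
Qed.

Lemma rsubst_monoid_morphism : monoid_morphism (rsubst v).
Proof.
split; first by rewrite -tofrac1 rsubst_poly peval1 tofrac1.
move=> x y; have [p [q [q0 ->]]] := rfracP x; have [r [s [s0 ->]]] := rfracP y.
by rewrite mulf_div -!tofracM !rsubst_frac ?mulf_neq0 // !(pevalM, tofracM) mulf_div.
Qed.

Lemma rsubst_cst c : rsubst v (rcst c) = rcst c.
Proof. by rewrite rsubst_poly pevalC. Qed.

Lemma rsubst_var i : rsubst v (rvar i) = v i.
Proof. by rewrite rsubst_poly pevalX. Qed.

End Subst.

(* Graph of the partial map p/q |-> peval v p / peval v q *)
Definition psubst (v : 'I_n -> F) (x y : F) := exists p q : P,
  [/\ peval v q != 0, x = p%:F / q%:F & y = peval v p / peval v q].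

Section Psubst.
Variable v : 'I_n -> F.

Let q_neq0 q : peval v q != 0 -> q != 0.
Proof. by apply: contra_neq => ->; rewrite (peval0, tofrac0). Qed.

Lemma psubst_poly (p : P) : psubst v p%:F (peval v p).
Proof. by exists p, 1; rewrite !(peval1, tofrac1) !divr1 oner_neq0. Qed.

Lemma psubst_var i : psubst v (rvar i) (v i).
Proof. by rewrite -[v i](pevalX v); apply: psubst_poly. Qed.

Lemma psubstD x y x' y' :
  psubst v x y -> psubst v x' y' -> psubst v (x + x') (y + y').
Proof.
move=> [p [q [q0 -> ->]]] [r [s [s0 -> ->]]].
exists (p * s + r * q), (q * s); split; first by rewrite pevalM (mulf_neq0 q0 s0).
  have qF : q%:F != 0 :> F by rewrite tofrac_eq0 q_neq0.
  have sF : s%:F != 0 :> F by rewrite tofrac_eq0 (q_neq0 s0).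
  by rewrite (addf_div _ _ qF sF) tofracD !tofracM.
by rewrite (addf_div _ _ q0 s0) pevalD !pevalM.
Qed.

Lemma psubstN x y : psubst v x y -> psubst v (- x) (- y).
Proof.
by move=> [p [q [q0 -> ->]]]; exists (- p), q; split; rewrite // (pevalN, tofracN) mulNr.
Qed.

Lemma psubstM x y x' y' :
  psubst v x y -> psubst v x' y' -> psubst v (x * x') (y * y').
Proof.
move=> [p [q [q0 -> ->]]] [r [s [s0 -> ->]]].
exists (p * r), (q * s); rewrite !pevalM !tofracM (mulf_neq0 q0 s0).
by rewrite !mulf_div.
Qed.

Lemma psubstV x y : y != 0 -> psubst v x y -> psubst v x^-1 y^-1.
Proof.
move=> y0 [p [q [q0 xE yE]]]; exists q, p.
have p0 : peval v p != 0 by apply: contra_neq y0 => p0; rewrite yE p0 mul0r.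
by rewrite p0 xE yE !invf_div.
Qed.

Lemma psubst_fun x y y' : psubst v x y -> psubst v x y' -> y = y'.
Proof.
move=> [p [q [q0 -> ->]]] [r [s [s0 /eqP e ->]]].
move: e; rewrite (rfrac_eq _ _ (q_neq0 q0) (q_neq0 s0)) => /eqP e.
by apply/eqP; rewrite (eqr_div _ _ q0 s0) -!pevalM e.
Qed.

End Psubst.

Lemma psubst_algindep (v w : 'I_n -> F) :
  (forall i, psubst v (w i) (rvar i)) -> algindep w.
Proof.
move=> vw p p0; have : psubst v (peval w p) p%:F.
  elim/pind: {p0} p => [c|i|p q|p q].
  - by rewrite pevalC -[X in psubst _ _ X](pevalC v c); apply: psubst_poly.
  - by rewrite pevalX; apply: vw.
  - by rewrite !(pevalD, tofracD); apply: psubstD.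
  - by rewrite !(pevalM, tofracM); apply: psubstM.
rewrite p0 => /psubst_fun/(_ (psubst_poly v 0)).
by rewrite (peval0, tofrac0) => /eqP; rewrite tofrac_eq0 => /eqP.
Qed.

Lemma rsubst_cancel (v w : 'I_n -> F) : algindep v -> algindep w ->
  (forall i, psubst v (w i) (rvar i)) -> cancel (rsubst w) (rsubst v).
Proof.
move=> vi wi vw x.
have vwp p : rsubst v (peval w p) = p%:F.
  elim/pind: p => [c|i|p q|p q]; first by rewrite pevalC rsubst_cst.
  - rewrite pevalX; have [p [q [q0 -> xE]]] := vw i.
    rewrite rsubst_frac -?xE //.
    by apply: contra_neq q0 => ->; rewrite (peval0, tofrac0).
  - by rewrite pevalD tofracD (zmod_morphismD (rsubst_zmod_morphism vi)) => -> ->.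
  - by rewrite pevalM tofracM (rsubst_monoid_morphism vi).2 => -> ->.
have [p [q [q0 ->]]] := rfracP x; rewrite (rsubst_frac wi _ q0).
have wq : peval w q != 0 by apply: contra_neq q0 => /wi.
have qF : q%:F != 0 :> F by rewrite tofrac_eq0.
apply: (mulIf qF); rewrite (divfK qF) -(vwp q) -(rsubst_monoid_morphism vi).2.
by rewrite (divfK wq) vwp.
Qed.

Section Der.
Variable v : 'I_n -> F.

Lemma pder_is_zmod_morphism : zmod_morphism (pder v).
Proof.
move=> p q; rewrite /pder -sumrB; apply: eq_bigr => i _.
by rewrite mderivB tofracB mulrBl.
Qed.

Lemma pderD : {morph pder v : p q / p + q}.
Proof. exact: zmod_morphismD pder_is_zmod_morphism. Qed.

Lemma pderM (p q : P) : pder v (p * q) = pder v p * q%:F + p%:F * pder v q.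
Proof.
rewrite /pder mulr_suml mulr_sumr -big_split; apply: eq_bigr => i _ /=.
by rewrite mderivM tofracD !tofracM mulrDl mulrAC mulrA.
Qed.

Lemma pderC c : pder v c%:MP = 0.
Proof. by rewrite /pder big1 // => i _; rewrite mderivC tofrac0 mul0r. Qed.

Lemma pderX i : pder v 'X_i = v i.
Proof.
rewrite /pder (bigD1 i) //= big1 => [|j ji].
  have U0 : (U_(i) - U_(i))%MM = 0%MM :> 'X_{1..n}.
    by apply/mnmP => j; rewrite mnmBE mnm0E subnn.
  by rewrite addr0 mderivX mnmE eqxx scale1r U0 mpolyX0 tofrac1 mul1r.
by rewrite mderivX mnmE eq_sym (negbTE ji) scale0r tofrac0 mul0r.
Qed.

Lemma rder_frac (p q : P) : q != 0 ->
  rder v (p%:F / q%:F) = (pder v p * q%:F - p%:F * pder v q) / q%:F ^+ 2.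
Proof.
move=> q0; rewrite /rder; set x := _ / q%:F.
have d0 := rden_neq0 x.
have /eqP := rnum_rden x; rewrite {1}/x (rfrac_eq _ _ q0 d0) => /eqP e.
apply/esym/quotient_rule_wd; [by rewrite tofrac_eq0|by rewrite tofrac_eq0| |].
  by rewrite -!tofracM e.
by rewrite -!pderM e.
Qed.

Lemma rderD x y : rder v (x + y) = rder v x + rder v y.
Proof.
have [p [q [q0 ->]]] := rfracP x; have [r [s [s0 ->]]] := rfracP y.
have qF : q%:F != 0 :> F by rewrite tofrac_eq0.
have sF : s%:F != 0 :> F by rewrite tofrac_eq0.
rewrite (addf_div _ _ qF sF) -!tofracM -tofracD.
rewrite (rder_frac _ (mulf_neq0 q0 s0)) (rder_frac _ q0) (rder_frac _ s0).
rewrite pderD !pderM tofracD !tofracM.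
exact: (quotient_ruleD p%:F r%:F (pder v p) (pder v q) (pder v r) (pder v s) qF sF).
Qed.

Lemma rderM x y : rder v (x * y) = rder v x * y + x * rder v y.
Proof.
have [p [q [q0 ->]]] := rfracP x; have [r [s [s0 ->]]] := rfracP y.
have qF : q%:F != 0 :> F by rewrite tofrac_eq0.
have sF : s%:F != 0 :> F by rewrite tofrac_eq0.
rewrite mulf_div -!tofracM.
rewrite (rder_frac _ (mulf_neq0 q0 s0)) (rder_frac _ q0) (rder_frac _ s0).
rewrite !pderM !tofracM.
exact: (quotient_ruleM p%:F r%:F (pder v p) (pder v q) (pder v r) (pder v s) qF sF).
Qed.

Lemma rder_poly (p : P) : rder v p%:F = pder v p.
Proof.
rewrite -[p%:F]divr1 -tofrac1 rder_frac ?oner_neq0 // tofrac1 expr1n divr1 mulr1.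
by rewrite -mpolyC1 pderC mulr0 subr0.
Qed.

Lemma rder_cst c : rder v (rcst c) = 0.
Proof. by rewrite rder_poly pderC. Qed.

Lemma rder_var i : rder v (rvar i) = v i.
Proof. by rewrite rder_poly pderX. Qed.

End Der.
End RationalFunctions.

Notation nvars l := (l.+1 + l.+1 + l.+1)%N (only parsing).

(* The field K(alpha; f; tau), in 3(l+1) independent variables; the index set
   Z/(l+1)Z is 'I_l.+1, with cyclic shifts. *)
Definition ratfun (K : fieldType) (l : nat) : fieldType :=
  {fraction {mpoly K[nvars l]}}.

Section NoumiYamada.
Context (K : fieldType) (l : nat).
Local Notation I := 'I_l.+1.
Local Notation F := (ratfun K l).

Definition sh (j : I) (r : nat) : I := inZp (j + r).

Definition alpha (j : I) : F := rvar (lshift _ (lshift _ j)).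
Definition f_ (j : I) : F := rvar (lshift _ (rshift _ j)).
Definition tau (j : I) : F := rvar (rshift _ j).

Definition assign (a b c : I -> F) (i : 'I_(nvars l)) : F :=
  match split i with
  | inl i' => match split i' with inl j => a j | inr j => b j end
  | inr j => c j
  end.

Definition k_ : F := \sum_(j : I) alpha j.

Definition s_var (i : I) : 'I_(nvars l) -> F := assign
  (fun j => if j == i then - alpha i
            else if (j == ordS i) || (j == ord_pred i) then alpha j + alpha i
            else alpha j)
  (fun j => if j == ordS i then f_ j + alpha i / f_ i
            else if j == ord_pred i then f_ j - alpha i / f_ i
            else f_ j)
  (fun j => if j == i then tau (ord_pred j) * tau (ordS j) / tau j * f_ j
            else tau j).

Definition s_ (i : I) : F -> F := rsubst (s_var i).

Definition perm_var (g : I -> I) : 'I_(nvars l) -> F :=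
  assign (alpha \o g) (f_ \o g) (tau \o g).

Definition pi_ : F -> F := rsubst (perm_var (@ordS _)).

(* The group of transformations of F generated by s_0, ..., s_l and pi, i.e.
   the image of the extended affine Weyl group. *)
Inductive weyl : (F -> F) -> Prop :=
| weyl_s i : weyl (s_ i)
| weyl_pi : weyl pi_
| weyl_id : weyl id
| weyl_comp w w' : weyl w -> weyl w' -> weyl (w \o w')
| weyl_inv w w' : weyl w -> cancel w w' -> cancel w' w -> weyl w'.

(* at i = 0 the formula gives varpi_0 = 0 *)
Definition varpi (i : I) : F :=
  \sum_(r : I | r != ord0)
    ((minn i r)%:R - (i * r)%:R / l.+1%:R) * alpha r.

Definition adjacent (i j : I) : bool := (j == ordS i) || (i == ordS j).

(* the connected components of the full subgraph of the cycle on C *)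
Definition components (C : {set I}) : {set {set I}} :=
  equivalence_partition
    (connect [rel i j | [&& i \in C, j \in C & adjacent i j]]) C.

Definition chain (j : I) (m : nat) : {set I} := [set sh j r | r : 'I_m].

Definition chi_chain (j : I) (m : nat) : F :=
  \sum_(r < m) (-1) ^+ r * varpi (sh j r).

(* A chain with 0 < m < l.+1 nodes determines (j, m), so each connected
   component of C is counted once, provided C is not the whole cycle. *)
Definition chi (C : {set I}) : F :=
  \sum_(j : I) \sum_(m : I | (0 < m)%N && (chain j m \in components C))
    chi_chain j m.

Definition even_chain (B : {set I}) : bool :=
  [exists j : I, exists m : I, ~~ odd m && (B == chain j m)].

Definition calS (d : nat) : {set {set I}} :=
  [set A : {set I} | (#|A| == d)
     && [forall B in components (~: A), even_chain B]].

Definition fprod (A : {set I}) : F := \prod_(i in A) f_ i.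

Definition h0 : F :=
  if odd l then
    \sum_(A in calS 4) fprod A + \sum_(A in calS 2) chi (~: A) * fprod A
      + (\sum_(i : I | i != ord0) (-1) ^+ i.-1 * varpi i) ^+ 2
  else
    \sum_(A in calS 3) fprod A + \sum_(A in calS 1) chi (~: A) * fprod A.

Definition h_ (j : I) : F := iter j pi_ h0.

Definition f_der (j : I) : F :=
  let n := l./2 in
  if odd l then
    f_ j * (\sum_(1 <= s < n.+1) \sum_(1 <= r < s.+1)
             f_ (sh j (2 * r - 1)) * f_ (sh j (2 * s))
           - \sum_(1 <= s < n.+1) \sum_(1 <= r < s.+1)
             f_ (sh j (2 * r)) * f_ (sh j (2 * s + 1)))
      + (k_ / 2 - \sum_(1 <= r < n.+1) alpha (sh j (2 * r))) * f_ j
      + alpha j * \sum_(1 <= r < n.+1) f_ (sh j (2 * r))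
  else
    f_ j * (\sum_(1 <= r < n.+1) f_ (sh j (2 * r - 1))
           - \sum_(1 <= r < n.+1) f_ (sh j (2 * r)))
      + alpha j.

Definition der : F -> F :=
  rder (assign (fun=> 0) f_der (fun j => h_ j * tau j / k_)).

(* der is the derivation, and s_ i, pi_ are the automorphisms, prescribed on the
   generators. *)

Lemma assign_alpha a b c j : assign a b c (lshift _ (lshift _ j)) = a j.
Proof. by rewrite /assign (unsplitK (inl (lshift _ j))) (unsplitK (inl j)). Qed.

Lemma assign_f a b c j : assign a b c (lshift _ (rshift _ j)) = b j.
Proof. by rewrite /assign (unsplitK (inl (rshift _ j))) (unsplitK (inr j)). Qed.

Lemma assign_tau a b c j : assign a b c (rshift _ j) = c j.
Proof. by rewrite /assign (unsplitK (inr j)). Qed.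

Lemma der_cst (c : K) : der (rcst c) = 0.
Proof. exact: rder_cst. Qed.

Lemma der_add : {morph der : x y / x + y}.
Proof. exact: rderD. Qed.

Lemma der_mul x y : der (x * y) = der x * y + x * der y.
Proof. exact: rderM. Qed.

Lemma der_alpha j : der (alpha j) = 0.
Proof. by rewrite /der rder_var assign_alpha. Qed.

Lemma der_f j : der (f_ j) = f_der j.
Proof. by rewrite /der rder_var assign_f. Qed.

Lemma k_neq0 : k_ != 0.
Proof.
have -> : k_ = (\sum_(j : I) 'X_(lshift l.+1 (lshift l.+1 j)))%:F.
  by rewrite rmorph_sum.
rewrite tofrac_eq0; apply/eqP => /(congr1 (mcoeff U_(lshift _ (lshift _ ord0)))).
rewrite mcoeff0 raddf_sum /= (bigD1 ord0) //= big1 => [|j j0].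
  by rewrite mcoeffX eqxx addr0 => /eqP; rewrite oner_eq0.
by rewrite mcoeffX eq_mnm1 !(inj_eq (@lshift_inj _ _)) (negbTE j0).
Qed.

Lemma der_tau j : k_ * der (tau j) = h_ j * tau j.
Proof. by rewrite /der rder_var assign_tau mulrC divfK // k_neq0. Qed.

Lemma rvar_neq0 (i : 'I_(nvars l)) : rvar i != 0 :> F.
Proof.
rewrite tofrac_eq0; apply/eqP => /(congr1 (mcoeff U_(i))).
by rewrite mcoeff0 mcoeffX eqxx => /eqP; rewrite oner_eq0.
Qed.

Lemma varP (Q : 'I_(nvars l) -> Prop) :
  (forall j, Q (lshift _ (lshift _ j))) ->
  (forall j, Q (lshift _ (rshift _ j))) -> (forall j, Q (rshift _ j)) ->
  forall i, Q i.
Proof.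
move=> Qa Qf Qt i; rewrite -[i]splitK; case: (split i) => [i'|j] //=.
by rewrite -[i']splitK; case: (split i').
Qed.

Section PermVar.
Variables g g' : I -> I.
Hypotheses (gK : cancel g g') (g'K : cancel g' g).

Lemma perm_psubst i : psubst (perm_var g') (perm_var g i) (rvar i).
Proof.
elim/varP: i => j; rewrite {2}/perm_var ?assign_alpha ?assign_f ?assign_tau /=.
- have := psubst_var (perm_var g') (lshift _ (lshift _ (g j))).
  by rewrite /perm_var assign_alpha /= gK.
- have := psubst_var (perm_var g') (lshift _ (rshift _ (g j))).
  by rewrite /perm_var assign_f /= gK.
have := psubst_var (perm_var g') (rshift _ (g j)).
by rewrite /perm_var assign_tau /= gK.
Qed.

Lemma perm_var_indep : algindep (perm_var g).
Proof. exact: psubst_algindep perm_psubst. Qed.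
End PermVar.

Let pi_indep := perm_var_indep (@ordSK l.+1).

Lemma pi_zmod_morphism : zmod_morphism pi_.
Proof. exact: rsubst_zmod_morphism. Qed.

Lemma pi_monoid_morphism : monoid_morphism pi_.
Proof. exact: rsubst_monoid_morphism. Qed.

Lemma pi_bij : bijective pi_.
Proof.
have vi := perm_var_indep (@ord_predK l.+1).
exists (rsubst (perm_var (@ord_pred _))); apply: rsubst_cancel => //.
  exact: perm_psubst (@ordSK l.+1).
exact: perm_psubst (@ord_predK l.+1).
Qed.

Lemma pi_cst (c : K) : pi_ (rcst c) = rcst c.
Proof. exact: rsubst_cst. Qed.

Lemma pi_alpha j : pi_ (alpha j) = alpha (ordS j).
Proof. by rewrite /pi_ rsubst_var // /perm_var assign_alpha. Qed.

Lemma pi_f j : pi_ (f_ j) = f_ (ordS j).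
Proof. by rewrite /pi_ rsubst_var // /perm_var assign_f. Qed.

Lemma pi_tau j : pi_ (tau j) = tau (ordS j).
Proof. by rewrite /pi_ rsubst_var // /perm_var assign_tau. Qed.

Section Reflections.
Hypothesis l_gt1 : (1 < l)%N.

Lemma ordS_neq (j : I) : ordS j != j.
Proof.
apply/eqP => /(congr1 val) /=; have [jl|jl] := eqVneq (j : nat) l.
  by rewrite jl modnn => l0; move: l_gt1; rewrite -l0.
rewrite modn_small; first by move/eqP; rewrite eqn_leq ltnn.
by rewrite ltnS ltn_neqAle jl -ltnS ltn_ord.
Qed.

Lemma ord_pred_neq (j : I) : ord_pred j != j.
Proof. by rewrite -{2}[j]ord_predK eq_sym ordS_neq. Qed.

Lemma ordS_neq_pred (j : I) : ordS j != ord_pred j.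
Proof.
rewrite -(inj_eq (can_inj (@ordSK l.+1))) ord_predK; apply/eqP => /(congr1 val) /=.
rewrite -addn1 modnDml addn1.
have jl : (j <= l)%N by rewrite -ltnS ltn_ord.
have [|jl'] := ltnP j.+2 l.+1.
  by move=> h; rewrite modn_small //; move/eqP; rewrite eqn_leq ltnNge leqnSn.
by rewrite -(subnK jl') modnDr modn_small; lia.
Qed.

Variable i : I.
Local Notation sv := (s_var i).
Let Si := ordS_neq i.
Let Pi := ord_pred_neq i.
Let SPi := ordS_neq_pred i.

Let sv_alpha j : psubst sv (alpha j)
  (if j == i then - alpha i
   else if (j == ordS i) || (j == ord_pred i) then alpha j + alpha i
   else alpha j).
Proof. by have := psubst_var sv (lshift _ (lshift _ j)); rewrite {2}/s_var assign_alpha. Qed.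

Let sv_f j : psubst sv (f_ j)
  (if j == ordS i then f_ j + alpha i / f_ i
   else if j == ord_pred i then f_ j - alpha i / f_ i
   else f_ j).
Proof. by have := psubst_var sv (lshift _ (rshift _ j)); rewrite {2}/s_var assign_f. Qed.

Let sv_tau j : psubst sv (tau j)
  (if j == i then tau (ord_pred j) * tau (ordS j) / tau j * f_ j else tau j).
Proof. by have := psubst_var sv (rshift _ j); rewrite {2}/s_var assign_tau. Qed.

Let sv_alphai : psubst sv (alpha i) (- alpha i).
Proof. by have := sv_alpha i; rewrite eqxx. Qed.

Let sv_fi : psubst sv (f_ i) (f_ i).
Proof. by have := sv_f i; rewrite ![i == _]eq_sym (negbTE Si) (negbTE Pi). Qed.

Let sv_alpha_div_f : psubst sv (alpha i / f_ i) (- (alpha i / f_ i)).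
Proof.
rewrite -mulNr; apply: psubstM => //; apply: psubstV => //; exact: rvar_neq0.
Qed.

Lemma s_psubst x : psubst sv (sv x) (rvar x).
Proof.
elim/varP: x => j; rewrite {2}/s_var ?assign_alpha ?assign_f ?assign_tau.
- have [->|ji] := eqVneq j i.
    by rewrite -[X in psubst _ _ X]opprK; apply: psubstN.
  have := sv_alpha j; rewrite (negbTE ji); case: ifP => // _ hj.
  by rewrite -[X in psubst _ _ X](addrK (alpha i)); apply: psubstD.
- have := sv_f j; have [->|jS] := eqVneq j (ordS i) => [hj|].
    rewrite -[X in psubst _ _ X](addrK (alpha i / f_ i)).
    by apply: psubstD.
  case: ifP => // _ hj.
  rewrite -[X in psubst _ _ X](subrK (alpha i / f_ i)).
  by apply: psubstD => //; rewrite -[X in psubst _ _ X]opprK; apply: psubstN.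
have [->|ji] := eqVneq j i; last by have := sv_tau j; rewrite (negbTE ji).
have t0 m : tau m != 0 by apply: rvar_neq0.
have f0 m : f_ m != 0 by apply: rvar_neq0.
have := sv_tau i; rewrite eqxx => hi.
have hS := sv_tau (ordS i); rewrite (negbTE Si) in hS.
have hP := sv_tau (ord_pred i); rewrite (negbTE Pi) in hP.
set T := (X in psubst sv (tau i) X) in hi.
have T0 : T != 0 by rewrite /T !mulf_neq0 ?invr_neq0.
have -> : rvar (rshift (l.+1 + l.+1) i)
    = tau (ord_pred i) * tau (ordS i) / T * f_ i.
  exact: (swap_quotient (t0 i) (t0 (ord_pred i)) (t0 (ordS i)) (f0 i)).
apply: psubstM sv_fi; apply: psubstM; first exact: psubstM hP hS.
exact: psubstV T0 hi.
Qed.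

Let s_indep : algindep sv.
Proof. exact: psubst_algindep s_psubst. Qed.

Lemma s_zmod_morphism : zmod_morphism (s_ i).
Proof. exact: rsubst_zmod_morphism. Qed.

Lemma s_monoid_morphism : monoid_morphism (s_ i).
Proof. exact: rsubst_monoid_morphism. Qed.

Lemma s_involutive : involutive (s_ i).
Proof. exact: rsubst_cancel s_psubst. Qed.

Lemma s_cst (c : K) : s_ i (rcst c) = rcst c.
Proof. exact: rsubst_cst. Qed.

Lemma s_alpha j : s_ i (alpha j) =
  if j == i then - alpha i
  else if (j == ordS i) || (j == ord_pred i) then alpha j + alpha i
  else alpha j.
Proof. by rewrite /s_ rsubst_var // /s_var assign_alpha. Qed.

Lemma s_f j : s_ i (f_ j) =
  if j == ordS i then f_ j + alpha i / f_ i
  else if j == ord_pred i then f_ j - alpha i / f_ i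
  else f_ j.
Proof. by rewrite /s_ rsubst_var // /s_var assign_f. Qed.

Lemma s_tau j : s_ i (tau j) =
  if j == i then tau (ord_pred j) * tau (ordS j) / tau j * f_ j else tau j.
Proof. by rewrite /s_ rsubst_var // /s_var assign_tau. Qed.

End Reflections.

End NoumiYamada.

(* Main.v *)
From HB Require Import structures.
Require Import Defs.
From mathcomp Require Import all_boot all_order all_algebra fingroup perm mpoly.
From mathcomp Require Import ring zify.

(** Commuting with the derivation passes to composites and inverses, and for an
    automorphism it may be tested on the generators alpha_j, f_j, tau_j
    ([der_commute]).  So only pi, under which all the formulas are equivariant,
    and the reflections s_i matter.

    Put F_j = 1 if l is even and F_j = f_j + f_(j+2) + ... + f_(j+l-1) if l is odd
    ([alpha_coef]), and define D_j ([flow_rate]) by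
    k D_j = 2 h_j - h_(j-1) - h_(j+1) ([h_second_diff]).  The case of s_i follows
    by rational identities from four facts:
    - s_i h_j = h_j for i different from j ([s_h]);
    - s_j h_j = h_j + k alpha_j F_j / f_j ([s_h_diag]);
    - f_j' = f_j D_j + alpha_j F_j ([f_derE]);
    - D_j + D_(j+1) = f_(j+1) F_j - f_j F_(j+1) ([flow_rate_step]).
    For instance, the first two and the definition of D_j give s_i D_j for all
    i and j, which together with the last two settles the generators f_j.

    The facts come from reading h_0 as a partition function.  Put
    beta_p = varpi_p - varpi_(p+1).  Cover the cycle by monomers, of weight
    t f_p, and by dominoes {p, p+1}, of weight 1 + t^2 beta_p, and let
    [dimer_sum] be the sum of the weights of all coverings.  A set K in S_d is
    the monomer set of exactly one covering, since an even chain has exactly one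
    tiling by dominoes ([sum_states]), and chi of its complement is the sum of
    the beta_p over the dominoes ([chi_beta]).  Hence h_0 is the coefficient of
    t^3 (l even) or of t^4 (l odd, up to half the sum of the beta_p^2): see
    [h0_even], [h0_odd].

    For i different from 0, s_i exchanges beta_(i-1) and beta_i ([s_beta]) and
    moves f_(i+1), f_(i-1) by alpha_i / f_i in opposite directions; summing over
    the edges at node i shows that the dimer sum does not change
    ([dimer_sum_swap]).  This is the first fact for j = 0, and rotation gives
    the other j.

    The same coefficient is affine in beta, up to an explicit square when l is
    odd; the coefficient of beta_p is the sum of the monomer products over the
    coverings that contain {p, p+1} ([monomer1], [monomer2]).  Since pi shifts
    beta up to constant multiples of k ([pi_beta]), the difference
    h_(j+1) - h_j is explicit ([h_step_even], [h_step_odd]).  So is D_j, and the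
    other facts become identities between the sums [monomer1] and [monomer2],
    which also occur in the definition of the derivation. *)

Set Implicit Arguments.
Unset Strict Implicit.
Unset Printing Implicit Defensive.

Import GRing.Theory Num.Theory.
Local Open Scope ring_scope.

(** * The cycle of indices *)

Section Cycle.
Context {l : nat}.
Local Notation I := 'I_l.+1.
Implicit Types (i j p x y a : I) (A C : {set I}).

Definition step_back (r : nat) p : I := iter r (@ord_pred _) p.

Lemma sh0 j : sh j 0 = j.
Proof. by apply/val_inj; rewrite /= addn0 modn_small. Qed.

Lemma shS j r : ordS (sh j r) = sh j r.+1.
Proof. by apply/val_inj; rewrite /= -addn1 modnDml addn1 addnS. Qed.

Lemma ordS_sh j : ordS j = sh j 1.
Proof. by rewrite -shS sh0. Qed.

Lemma ordS_eq i j : (ordS i == ordS j) = (i == j).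
Proof. exact: inj_eq (can_inj (@ordSK l.+1)) i j. Qed.

Lemma sum_ordS (V : nmodType) (u : I -> V) : \sum_i u (ordS i) = \sum_i u i.
Proof. by rewrite [RHS](reindex_inj (can_inj (@ordSK l.+1))). Qed.

Lemma sh_iter j r : sh j r = iter r (@ordS _) j.
Proof. by elim: r => [|r IH] /=; rewrite ?sh0 // -shS IH. Qed.

Lemma shSl j r : sh (ordS j) r = sh j r.+1.
Proof. by rewrite !sh_iter -iterSr. Qed.

Lemma shD j r s : sh (sh j r) s = sh j (r + s)%N.
Proof. by rewrite addnC !sh_iter iterD. Qed.

Lemma sh_full j : sh j l.+1 = j.
Proof. by apply/val_inj; rewrite /= modnDr modn_small. Qed.

Lemma sh_eq j r s : (r < l.+1)%N -> (s < l.+1)%N -> (sh j r == sh j s) = (r == s).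
Proof.
move=> rN sN; apply/eqP/eqP => [/(congr1 val)/= /eqP|-> //].
by rewrite eqn_modDl !modn_small // => /eqP.
Qed.

Lemma shK j r : step_back r (sh j r) = j.
Proof.
by elim: r => [|r IH]; rewrite ?sh0 // /step_back iterSr -shS ordSK -/(step_back _ _).
Qed.

Lemma step_backK j r : sh (step_back r j) r = j.
Proof. by elim: r => [|r IH]; rewrite ?sh0 //= -shSl ord_predK. Qed.

Lemma step_back_sh j r s : (s <= r)%N -> step_back s (sh j r) = sh j (r - s)%N.
Proof. by move=> sr; rewrite -[in LHS](subnK sr) -shD shK. Qed.

Lemma sh_surj x y : exists2 r, (r < l.+1)%N & y = sh x r.
Proof.
exists ((y + (l.+1 - x)) %% l.+1)%N; first by rewrite ltn_mod.
apply/val_inj; rewrite /= modnDmr addnCA subnKC; last exact: ltnW.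
by rewrite modnDr modn_small.
Qed.

Lemma ord_pred_sh j : ord_pred j = sh j l.
Proof. by rewrite -[LHS](sh_full) -shSl ord_predK. Qed.

Lemma step_backS r p : step_back r (ord_pred p) = step_back r.+1 p.
Proof. by rewrite /step_back iterSr. Qed.

(** Distances are counted backwards because the signs in [chi] are counted from
    the first node of a chain, which is the successor of an element of [A]. *)
Definition dist_back A p := find (fun r => step_back r p \in A) (iota 0 l.+1).

Lemma dist_back_spec A p : A != set0 ->
  [/\ (dist_back A p < l.+1)%N, step_back (dist_back A p) p \in A &
      forall u, (u < dist_back A p)%N -> step_back u p \notin A].
Proof.
case/set0Pn => a aA.
have hasA : has (fun r => step_back r p \in A) (iota 0 l.+1).
  have [r rN pE] := sh_surj a p; apply/hasP; exists r; first by rewrite mem_iota.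
  by rewrite pE shK.
have gN : (dist_back A p < l.+1)%N by move: hasA; rewrite has_find size_iota.
split=> //; first by have := nth_find 0%N hasA; rewrite nth_iota.
move=> u ug; have := before_find 0%N ug.
by rewrite nth_iota ?(ltn_trans ug) // add0n => ->.
Qed.

Lemma dist_back_uniq A p g : step_back g p \in A ->
  (forall u, (u < g)%N -> step_back u p \notin A) ->
  dist_back A p = g.
Proof.
move=> gA ug; have A0 : A != set0 by apply/set0Pn; exists (step_back g p).
have [bN bA ub] := dist_back_spec p A0.
have [/ug|/ub|//] := ltngtP (dist_back A p) g; by rewrite ?bA ?gA.
Qed.

Lemma dist_back_in A p : p \in A -> dist_back A p = 0%N.
Proof. by move=> pA; apply: dist_back_uniq. Qed.

Lemma dist_back_notin A p : A != set0 -> p \notin A ->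
  dist_back A p = (dist_back A (ord_pred p)).+1.
Proof.
move=> A0 pA; have [_ bA ub] := dist_back_spec (ord_pred p) A0.
apply: dist_back_uniq; first by rewrite -step_backS.
by case=> // u; rewrite ltnS -step_backS => /ub.
Qed.

Definition anchor A p := step_back (dist_back A p) p.

Lemma anchor_in A p : A != set0 -> anchor A p \in A.
Proof. by move=> A0; have [] := dist_back_spec p A0. Qed.

Lemma anchorK A p : sh (anchor A p) (dist_back A p) = p.
Proof. exact: step_backK. Qed.

Lemma anchor_notin A p : A != set0 -> p \notin A -> anchor A p = anchor A (ord_pred p).
Proof. by move=> A0 pA; rewrite /anchor dist_back_notin // step_backS. Qed.

Definition arc A a := [set y | (y \notin A) && (anchor A y == a)].

Local Notation rl C := [rel i j | [&& i \in C, j \in C & adjacent i j]].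

Lemma connect_sym_rl C : connect_sym (rl C).
Proof.
apply: sym_connect_sym => i j /=; rewrite /adjacent andbCA.
by congr [&& _, _ & _]; rewrite orbC.
Qed.

(** An edge with both ends [p], [p+1] outside [A] joins nodes with the same
    anchor, so the anchor is constant on components; conversely, stepping back
    joins every node outside [A] to the successor of its anchor. *)
Lemma connect_anchor A x y : A != set0 -> x \notin A ->
  (y \notin A) && connect (rl (~: A)) x y
  = (y \notin A) && (anchor A y == anchor A x).
Proof.
move=> A0 xA; apply: andb_id2l => yA; apply/idP/eqP => [cxy|axy].
  pose P := [pred z | anchor A z == anchor A x].
  suff clP : closed (rl (~: A)) P.
    by have := closed_connect clP cxy; rewrite !inE eqxx => /esym/eqP.
  move=> u v /= /and3P[]; rewrite !inE => uA vA /orP[]/eqP e.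
    by rewrite e (anchor_notin A0 (p := ordS u)) ?ordSK // -e.
  by rewrite e (anchor_notin A0 (p := ordS v)) ?ordSK // -e.
have toA z : z \notin A -> connect (rl (~: A)) z (ordS (anchor A z)).
  move: {2}(dist_back A z) (leqnn (dist_back A z)) => g.
  elim: g z => [|g IH] z gz zA; first by move: gz; rewrite (dist_back_notin A0 zA).
  have [pA|pA] := boolP (ord_pred z \in A).
    by rewrite (anchor_notin A0 zA) /anchor dist_back_in //= ord_predK connect0.
  rewrite (anchor_notin A0 zA).
  apply: connect_trans (IH _ _ pA); last first.
    by move: gz; rewrite (dist_back_notin A0 zA).
  by apply: connect1; rewrite /= !inE zA pA /adjacent ord_predK eqxx orbT.
apply: connect_trans (toA _ xA) _; rewrite connect_sym_rl -axy.
exact: toA.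
Qed.

Lemma componentsE A : A != set0 ->
  components (~: A) = [set arc A (anchor A x) | x in ~: A].
Proof.
move=> A0; apply: eq_in_imset => x; rewrite inE => xA.
by apply/setP => y; rewrite !inE -connect_anchor.
Qed.

Definition gap A a := find (fun r => sh (ordS a) r \in A) (iota 0 l.+1).

Lemma gap_spec A a : a \in A ->
  [/\ (gap A a < l.+1)%N, sh (ordS a) (gap A a) \in A &
      forall u, (u < gap A a)%N -> sh (ordS a) u \notin A].
Proof.
move=> aA.
have hasA : has (fun r => sh (ordS a) r \in A) (iota 0 l.+1).
  apply/hasP; exists l; first by rewrite mem_iota add0n ltnSn.
  by rewrite shSl sh_full.
have gN : (gap A a < l.+1)%N by move: hasA; rewrite has_find size_iota.
split=> //; first by have := nth_find 0%N hasA; rewrite nth_iota.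
move=> u ug; have := before_find 0%N ug.
by rewrite nth_iota ?(ltn_trans ug) // add0n => ->.
Qed.

Lemma dist_back_gap A a r : a \in A -> (r <= gap A a)%N -> dist_back A (sh a r) = r.
Proof.
move=> aA rG; have [_ _ ug] := gap_spec aA.
apply: dist_back_uniq; first by rewrite shK.
move=> u ur; rewrite step_back_sh 1?ltnW //.
have -> : (r - u = (r - u).-1.+1)%N by lia.
by rewrite -shSl; apply: ug; lia.
Qed.

Lemma mem_arc A a r : a \in A -> (r < gap A a)%N -> sh (ordS a) r \in arc A a.
Proof.
move=> aA rG; have [_ _ ug] := gap_spec aA.
by rewrite inE ug // /anchor shSl (dist_back_gap aA) // shK eqxx.
Qed.

Lemma arcP A a y : a \in A -> y \in arc A a ->
  exists2 r, (r < gap A a)%N & y = sh (ordS a) r.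
Proof.
move=> aA; rewrite inE => /andP[yA /eqP ay].
have A0 : A != set0 by apply/set0Pn; exists a.
have [_ _ ub] := dist_back_spec y A0; have [_ gA _] := gap_spec aA.
have yE := anchorK A y; rewrite ay in yE.
have b0 : dist_back A y = (dist_back A y).-1.+1 by rewrite (dist_back_notin A0 yA).
exists (dist_back A y).-1; last by rewrite shSl -b0.
rewrite -b0 leqNgt; apply/negP => gb.
have := ub (dist_back A y - (gap A a).+1)%N.
rewrite -[X in step_back _ X]yE step_back_sh ?leq_subr // subKn // -shSl gA.
by rewrite b0 => /(_ _)/negP []; lia.
Qed.

Lemma arc_chain A a : a \in A -> arc A a = chain (ordS a) (gap A a).
Proof.
move=> aA; apply/setP => y; apply/idP/imsetP => [/(arcP aA)[r rG ->]|[r _ ->]].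
  by exists (Ordinal rG).
exact: mem_arc.
Qed.

Lemma card_chain j m : (m <= l.+1)%N -> #|chain j m| = m.
Proof.
move=> mN; rewrite card_in_imset ?card_ord // => r s _ _ /eqP.
by rewrite sh_eq ?(leq_trans (ltn_ord _)) // => /eqP/val_inj.
Qed.

Lemma card_arc A a : a \in A -> #|arc A a| = gap A a.
Proof.
by move=> aA; rewrite arc_chain // card_chain //; have [/ltnW] := gap_spec aA.
Qed.

Lemma even_arc A a : a \in A -> even_chain (arc A a) = ~~ odd (gap A a).
Proof.
move=> aA; apply/existsP/idP => [[j /existsP[m /andP[mE /eqP cE]]]|gE].
  by rewrite -card_arc // cE card_chain // ltnW.
have [gl _ _] := gap_spec aA.
by exists (ordS a); apply/existsP; exists (Ordinal gl); rewrite /= gE arc_chain //=.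
Qed.

Definition even_gaps A := [forall p in A, ~~ odd (dist_back A (ord_pred p))].

(** A component of the complement is an arc, and its length is the distance back
    from the node that precedes the next element of [A]. *)
Lemma even_gapsP A : A != set0 ->
  [forall B in components (~: A), even_chain B] = even_gaps A.
Proof.
move=> A0; rewrite componentsE //; apply/forall_inP/forall_inP => [H p pA|H B].
  set q := ord_pred p; have [qA|qA] := boolP (q \in A); first by rewrite dist_back_in.
  set a := anchor A q; have aA : a \in A by apply: anchor_in.
  have : even_chain (arc A a) by apply: H; apply: imset_f; rewrite inE.
  rewrite even_arc //; suff -> : gap A a = dist_back A q by [].
  have [gl gA ug] := gap_spec aA.
  have pE : p = sh (ordS a) (dist_back A q) by rewrite shSl -shS anchorK ord_predK.
  have [lt|lt|//] := ltngtP (gap A a) (dist_back A q); last first.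
    by have := ug _ lt; rewrite -pE pA.
  have [_ _ ub] := dist_back_spec q A0.
  have := ub (dist_back A q - (gap A a).+1)%N.
  rewrite -[X in step_back _ X](anchorK A q) step_back_sh ?leq_subr // subKn // -shSl gA.
  by move=> /(_ _)/negP []; lia.
case/imsetP => x; rewrite inE => xA ->.
have aA := anchor_in x A0; rewrite even_arc //.
have [gl gA ug] := gap_spec aA.
by have := H _ gA; rewrite shSl -shS ordSK dist_back_gap.
Qed.

Lemma calSE d A : (0 < d)%N -> (A \in calS l d) = (#|A| == d) && even_gaps A.
Proof.
move=> d0; rewrite inE; apply: andb_id2l => /eqP cA.
by rewrite even_gapsP // -card_gt0 cA.
Qed.

End Cycle.

Section Chi.
Context (K : fieldType) (l : nat).
Local Notation I := 'I_l.+1.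
Local Notation varpi := (varpi K).
Implicit Types (A : {set I}).

(** A nonempty arc is [chain (ordS a) m] for a single pair [(a, m)]: since
    [m <= l] the chain does not close up, so its first node is the only one whose
    predecessor is missing.  Empty arcs contribute empty sums. *)
Lemma chi_arcs A : A != set0 ->
  chi K (~: A) = \sum_(a in A) chi_chain K (ordS a) (gap A a).
Proof.
move=> A0; rewrite /chi [RHS]big_mkcond (reindex_inj (can_inj (@ordSK l.+1))) /=.
apply: eq_bigr => a _; case: ifPn => aA; last first.
  apply: big1 => m /andP[m0]; rewrite componentsE // => /imsetP[x].
  rewrite inE => xA cE; have := anchor_in x A0; move: cE; set b := anchor A x => cE bA.
  have /(_ 0%N)/(_ m0) c0 r (rm : (r < m)%N) : sh (ordS a) r \in chain (ordS a) m.
    by apply/imsetP; exists (Ordinal rm).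
  move: c0; rewrite sh0 cE inE => /andP[SA /eqP]; rewrite (anchor_notin A0 SA) ordSK => ab.
  have : a \in arc A b by rewrite inE aA ab eqxx.
  rewrite -cE => /imsetP[r _ /eqP]; rewrite -{1}(sh_full a) -shSl.
  have rm := ltn_ord r; have ml := ltn_ord m.
  rewrite sh_eq // => [/eqP rl|]; last exact: ltn_trans rm ml.
  by move: rm ml; rewrite -rl; lia.
have [gl gA ug] := gap_spec aA.
have compE (m : I) : (0 < m)%N && (chain (ordS a) m \in components (~: A))
    = (0 < m)%N && ((m : nat) == gap A a).
  apply: andb_id2l => m0; rewrite componentsE //.
  apply/imsetP/eqP => [[x]|mE].
    rewrite inE => xA cE; have := anchor_in x A0.
    move: cE; set b := anchor A x => cE bA.
    have : ordS a \in chain (ordS a) m.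
      by apply/imsetP; exists (Ordinal m0); rewrite // sh0.
    rewrite cE inE => /andP[SA]; rewrite (anchor_notin A0 SA) ordSK.
    have -> : anchor A a = a by rewrite /anchor dist_back_in.
    move/eqP => ab; rewrite -(@card_arc _ A a aA) ab -cE card_chain // ltnW //.
  exists (sh (ordS a) 0); last first.
    rewrite mE -arc_chain //; have := mem_arc aA (r := 0).
    by rewrite -mE m0 inE => /(_ isT)/andP[_ /eqP->].
  by rewrite inE ug // -mE.
rewrite (eq_bigl _ _ compE); have [g0|g0] := posnP (gap A a).
  rewrite g0 /chi_chain big_ord0 big_pred0 // => m.
  by case: (nat_of_ord m).
rewrite (big_pred1 (Ordinal gl)) // => m /=.
by apply/andP/eqP => [[_ /eqP mE]|-> //]; apply/val_inj.
Qed.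

Lemma chiE A : A != set0 ->
  chi K (~: A) = \sum_(y | y \notin A) (-1) ^+ (dist_back A y).-1 * varpi y.
Proof.
move=> A0; rewrite chi_arcs //.
rewrite [RHS](partition_big (anchor A) (mem A)) /=; last first.
  by move=> y _; apply: anchor_in.
apply: eq_bigr => a aA; rewrite /chi_chain.
have -> : \sum_(i | (i \notin A) && (anchor A i == a)) (-1) ^+ (dist_back A i).-1 * varpi i
   = \sum_(i in arc A a) (-1) ^+ (dist_back A i).-1 * varpi i.
  by apply: eq_bigl => y; rewrite inE.
rewrite arc_chain // big_imset /=; last first.
  have [gl _ _] := gap_spec aA.
  move=> r s _ _ /eqP; rewrite sh_eq ?(ltn_trans (ltn_ord _)) //.
  by move=> /eqP/val_inj.
apply: eq_big => [r|r _]; first by rewrite inE.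
by rewrite shSl dist_back_gap.
Qed.
End Chi.

(** * States of the edges and sets with even gaps *)

Section States.
Context {l : nat}.
Local Notation I := 'I_l.+1.
Local Notation state := {ffun I -> bool}.
Implicit Types (i p : I) (A : {set I}) (s : state).

(** A state records, for each [p], whether the edge from [p] to [p+1] carries a
    domino.  It is admissible when no two dominoes overlap; its monomers are the
    nodes that no domino covers. *)
Definition admissible s := [forall i, ~~ (s (ord_pred i) && s i)].
Definition monomers s : {set I} := [set i | ~~ s (ord_pred i) & ~~ s i].
(** The tiling of the arcs of [A]: dominoes start at the nodes at odd distance
    from the preceding element of [A]. *)
Definition state_of A : state := [ffun p => odd (dist_back A p)].

Lemma monomers_even_gaps A : A != set0 ->
  admissible (state_of A) && (monomers (state_of A) == A) = even_gaps A.
Proof.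
move=> A0; have E p : p \notin A ->
    odd (dist_back A p) = ~~ odd (dist_back A (ord_pred p)).
  by move=> pA; rewrite dist_back_notin.
apply/andP/forall_inP => [[_ /eqP fA] p|H].
  by rewrite -{1}fA inE !ffunE => /andP[].
split.
  apply/forallP => p; rewrite !ffunE; have [pA|/E ->] := boolP (p \in A).
    by rewrite (dist_back_in pA) andbF.
  by rewrite andbN.
apply/eqP/setP => p; rewrite inE !ffunE; have [pA|/E ->] := boolP (p \in A).
  by rewrite (dist_back_in pA) H.
by rewrite andbN.
Qed.

(** From a monomer onwards, the edges of an admissible state are forced to
    alternate until the next monomer. *)
Lemma state_ofK s : admissible s -> monomers s != set0 -> state_of (monomers s) = s.
Proof.
move=> /forallP ok A0; apply/ffunP => p; rewrite ffunE.
move: {2}(dist_back _ p) (leqnn (dist_back (monomers s) p)) => g.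
elim: g p => [|g IH] p gp; have [pA|pA] := boolP (p \in monomers s).
- by move: (pA); rewrite dist_back_in // inE => /andP[_ /negbTE].
- by move: gp; rewrite dist_back_notin.
- by move: (pA); rewrite dist_back_in // inE => /andP[_ /negbTE].
move: gp; rewrite dist_back_notin // ltnS => /IH /= ->.
by move: pA (ok p); rewrite inE; case: (s p); case: (s (ord_pred p)).
Qed.

(** A chain has a tiling by dominoes only if it is even, and then exactly one;
    so the sets in [calS l d] are the monomer sets of the admissible states with
    [d] monomers. *)
Lemma sum_states (V : nmodType) d (X : {set I} -> state -> V) : (0 < d)%N ->
  \sum_(s | admissible s && (#|monomers s| == d)) X (monomers s) s
  = \sum_(A in calS l d) X A (state_of A).
Proof.
move=> d0; have n0 A : #|A| = d -> A != set0 by move=> cA; rewrite -card_gt0 cA.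
rewrite (reindex_onto state_of monomers) /=; last first.
  by move=> s /andP[ok /eqP/n0]; exact: state_ofK.
apply: eq_big => [A|A /andP[_ /eqP->] //]; rewrite calSE //.
apply/andP/andP => [[/andP[ok cA] fA]|[cA gA]].
  move: (fA) cA => /eqP-> cA; rewrite cA -monomers_even_gaps ?ok //.
  by apply: n0; apply/eqP.
move: gA; rewrite -monomers_even_gaps; last by apply: n0; apply/eqP.
by case/andP=> -> /eqP ->.
Qed.

Lemma even_gaps_succ A p : A != set0 -> even_gaps A ->
  ((p \notin A) && ~~ odd (dist_back A p)) = odd (dist_back A (ord_pred p)).
Proof.
move=> A0 /forall_inP H; have [pA|pA] := boolP (p \in A).
  by rewrite (negbTE (H p pA)).
by rewrite dist_back_notin //= negbK.
Qed.

Lemma odd_ord_pred p : odd l -> odd (ord_pred p) = ~~ odd p.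
Proof.
move=> lo; case: p => -[|p] pl /=; first by rewrite modn_small.
by rewrite modnDr modn_small 1?ltnW //= negbK.
Qed.

(** Without monomers the edges alternate all around the cycle. *)
Lemma alternating_states (V : nmodType) (X : state -> V) : odd l ->
  \sum_(s | admissible s && (#|monomers s| == 0)) X s
  = X [ffun p : I => odd p] + X [ffun p : I => ~~ odd p].
Proof.
move=> lo; set so := [ffun p : I => odd p]; set se := [ffun p : I => ~~ odd p].
have predE p := odd_ord_pred p lo.
have PE s : admissible s && (#|monomers s| == 0) = (s == so) || (s == se).
  apply/andP/orP => [[/forallP ok]|]; last first.
    case=> /eqP->; split.
    - by apply/forallP => p; rewrite !ffunE predE; case: odd.
    - by rewrite cards_eq0; apply/eqP/setP => p; rewrite !inE !ffunE predE; case: odd.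
    - by apply/forallP => p; rewrite !ffunE predE; case: odd.
    - by rewrite cards_eq0; apply/eqP/setP => p; rewrite !inE !ffunE predE; case: odd.
  rewrite cards_eq0 => /eqP f0.
  have alt p : s p = ~~ s (ord_pred p).
    have := ok p; have /setP/(_ p) := f0; rewrite !inE.
    by case: (s p); case: (s (ord_pred p)).
  have sE p : s p = s ord0 (+) odd p.
    case: p => m; elim: m => [|m IH] ml.
      by rewrite addbF; congr (s _); apply: val_inj.
    rewrite alt; have -> : ord_pred (Ordinal ml) = Ordinal (ltnW ml).
      apply: val_inj => /=; by rewrite modnDr modn_small // ltnW.
    by rewrite IH /= addbN.
  case s0: (s ord0); [right|left]; apply/eqP/ffunP => p; by rewrite ffunE sE s0.
rewrite (eq_bigl _ _ PE) (bigD1 so) ?eqxx //= (big_pred1 se) // => s /=.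
have [->|] := eqVneq s so; last by rewrite orFb andbT.
apply/esym/eqP => /ffunP/(_ ord0); by rewrite !ffunE.
Qed.
End States.

Section PartitionFunction.
Context {F : fieldType} {l : nat}.
Local Notation I := 'I_l.+1.
Local Notation state := {ffun I -> bool}.
Implicit Types (i p : I) (A : {set I}) (s : state) (f b : I -> F).

(** Weight of node [i] when [x] and [y] tell whether the edges on its left and on
    its right carry a domino; the weight of a domino is attached to its first
    node.  The variable has degree 1 on monomers and 2 on dominoes, so that the
    coefficients of low degree single out states with few monomers. *)
Definition local_weight f b i (x y : bool) : {poly F} :=
  if x then if y then 0 else 1
  else if y then 1 + (b i)%:P * 'X^2 else (f i)%:P * 'X.

Definition weight f b s : {poly F} :=
  \prod_i local_weight f b i (s (ord_pred i)) (s i).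

Definition dimer_sum f b : {poly F} := \sum_s weight f b s.

Lemma dimer_sum_rot f b : dimer_sum (f \o (@ordS _)) (b \o (@ordS _)) = dimer_sum f b.
Proof.
rewrite /dimer_sum (reindex (fun s : state => [ffun p => s (ordS p)])) /=; last first.
  exists (fun s => [ffun p => s (ord_pred p)]) => s _; apply/ffunP => p.
    by rewrite !ffunE ord_predK.
  by rewrite !ffunE ordSK.
apply: eq_bigr => s _; rewrite /weight [RHS](reindex_inj (can_inj (@ordSK l.+1))).
by apply: eq_bigr => i _; rewrite !ffunE ordSK ord_predK.
Qed.

Definition flip p s : state := [ffun q => s q (+) (q == p)].

Lemma flipK p : involutive (flip p).
Proof. by move=> s; apply/ffunP => q; rewrite !ffunE -addbA addbb addbF. Qed.

Lemma sum_flip (V : nmodType) (G : state -> V) p :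
  \sum_s G (flip p s) = \sum_s G s.
Proof. by rewrite [RHS](reindex_inj (can_inj (flipK p))). Qed.

Lemma sum_bool2 (V : nmodType) (T : bool -> bool -> V) x y :
  \sum_(u : bool) \sum_(v : bool) T u v
  = T x y + T (~~ x) y + (T x (~~ y) + T (~~ x) (~~ y)).
Proof.
have E a c d e : a + c + (d + e) = a + d + (c + e) :> V by rewrite addrACA.
rewrite !big_bool; case: x; case: y => /=; rewrite E //.
- by rewrite addrC.
- by rewrite (addrC (T true true)) (addrC (T true false)).
- by rewrite addrC (addrC (T true true)) (addrC (T true false)).
Qed.

(** The two edges at node [i] enter three local weights only.  For fixed outer
    edges [u] and [v], the sum over the two inner ones is the same before and after the
    change: the relation between [b i], [b (ord_pred i)] and [e] makes the terms
    of first and second order in [e] cancel. *)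
Lemma local_swap f b f' b' i e (u v : bool) :
  b i = b (ord_pred i) + e * f i ->
  f' i = f i -> f' (ordS i) = f (ordS i) + e -> f' (ord_pred i) = f (ord_pred i) - e ->
  b' i = b (ord_pred i) -> b' (ord_pred i) = b i -> b' (ordS i) = b (ordS i) ->
  \sum_(x : bool) \sum_(y : bool) local_weight f' b' (ord_pred i) u x
     * (local_weight f' b' i x y * local_weight f' b' (ordS i) y v)
  = \sum_(x : bool) \sum_(y : bool) local_weight f b (ord_pred i) u x
     * (local_weight f b i x y * local_weight f b (ordS i) y v).
Proof.
move=> bi fi fS fP b'i b'P b'S; rewrite !big_bool /= /local_weight.
rewrite fi fS fP b'i b'P b'S bi !polyCD !polyCM polyCN.
by case: u; case: v; rewrite ?(mul0r, mulr0, mul1r, mulr1, add0r, addr0); ring.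
Qed.

Hypothesis l_gt1 : (1 < l)%N.
Hypothesis two_neq0 : 2%:R != 0 :> F.

Lemma pred2_neq i : ord_pred (ord_pred i) != i.
Proof.
apply/eqP => e; have := ordS_neq_pred l_gt1 (ord_pred i).
by rewrite ord_predK e eqxx.
Qed.

(** The terms are grouped by the values of the state off the two edges at [i];
    [local_swap] applies to each group.  Each group is counted four times, once
    for each of its members. *)
Lemma dimer_sum_swap f b i e : b i = b (ord_pred i) + e * f i ->
  dimer_sum (fun j => if j == ordS i then f j + e
              else if j == ord_pred i then f j - e else f j)
    (fun j => if j == i then b (ord_pred i) else if j == ord_pred i then b i else b j)
  = dimer_sum f b.
Proof.
set f' := (X in dimer_sum X _); set b' := (X in dimer_sum _ X) => bi.
set p := ord_pred i; set S := ordS i.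
have Si : S != i by apply: ordS_neq.
have Pi : p != i by apply: ord_pred_neq.
have SP : S != p by apply: ordS_neq_pred.
have iS : i != S by rewrite eq_sym.
have iP : i != p by rewrite eq_sym.
have PP : ord_pred p != p by apply: ord_pred_neq.
have PPi : ord_pred p != i by apply: pred2_neq.
have predS : ord_pred S = i by rewrite ordSK.
pose R g c s := \prod_(j | (j != p) && (j != i) && (j != S))
  local_weight g c j (s (ord_pred j)) (s j).
have split g c s : weight g c s = local_weight g c p (s (ord_pred p)) (s p)
    * (local_weight g c i (s p) (s i) * local_weight g c S (s i) (s S)) * R g c s.
  rewrite /weight (bigD1 p) //= (bigD1 i) //= (bigD1 S) /=; last by rewrite SP Si.
  by rewrite predS !mulrA.
pose four g c s := weight g c s + weight g c (flip p s)
   + (weight g c (flip i s) + weight g c (flip p (flip i s))).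
have fourE g c : \sum_s four g c s = 4%:R * dimer_sum g c.
  rewrite /four !big_split /= (sum_flip (weight g c)).
  rewrite (sum_flip (fun s => weight g c (flip p s))) !sum_flip -/(dimer_sum g c).
  by rewrite mulr_natl -!mulr2n -mulrnA.
have four0 : 4%:R != 0 :> {poly F}.
  by rewrite -polyC_natr polyC_eq0 (natrM _ 2 2) mulf_neq0.
apply: (mulfI four0); rewrite -!fourE; apply: eq_bigr => s _; rewrite /four.
have f'i : f' i = f i by rewrite /f' (negbTE iS) (negbTE iP).
have f'S : f' S = f S + e by rewrite /f' eqxx.
have f'p : f' p = f p - e by rewrite /f' -/p -/S eq_sym (negbTE SP) eqxx.
have b'i : b' i = b p by rewrite /b' eqxx.
have b'p : b' p = b i by rewrite /b' -/p (negbTE Pi) eqxx.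
have b'S : b' S = b S by rewrite /b' -/p (negbTE Si) (negbTE SP).
have RE g c s' : (forall j, j != p -> j != i -> s' j = s j) ->
   (forall j, j != p -> j != i -> j != S -> g j = f j /\ c j = b j) ->
   R g c s' = R f b s.
  move=> ss gc; apply: eq_bigr => j /andP[/andP[jp ji] jS].
  have jpp : ord_pred j != p by rewrite (inj_eq (can_inj (@ord_predK l.+1))).
  have jpi : ord_pred j != i.
    by apply: contra_neq jS => e'; rewrite /S -e' ord_predK.
  have [gE cE] := gc j jp ji jS.
  by rewrite /local_weight gE cE !ss.
have gc1 j : j != p -> j != i -> j != S -> f j = f j /\ b j = b j by [].
have gc2 j : j != p -> j != i -> j != S -> f' j = f j /\ b' j = b j.
  by move=> jp ji jS; rewrite /f' /b' -/p -/S (negbTE jp) (negbTE ji) (negbTE jS).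
have flE q s' j : flip q s' j = if j == q then ~~ s' j else s' j.
  by rewrite ffunE; case: eqP => _; rewrite ?addbT ?addbF.
have fl1 j : j != p -> j != i -> flip p s j = s j.
  by move=> jp ji; rewrite flE (negbTE jp).
have fl2 j : j != p -> j != i -> flip i s j = s j.
  by move=> jp ji; rewrite flE (negbTE ji).
have fl3 j : j != p -> j != i -> flip p (flip i s) j = s j.
  by move=> jp ji; rewrite !flE (negbTE jp) (negbTE ji).
have id0 : forall j, j != p -> j != i -> s j = s j by [].
have R0 := RE f' b' s id0 gc2.
have R1 := RE f' b' _ fl1 gc2; have R1' := RE f b _ fl1 gc1.
have R2 := RE f' b' _ fl2 gc2; have R2' := RE f b _ fl2 gc1.
have R3 := RE f' b' _ fl3 gc2; have R3' := RE f b _ fl3 gc1.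
rewrite !split R0 R1 R1' R2 R2' R3 R3' -!mulrDl; congr (_ * _).
have := local_swap (s (ord_pred p)) (s S) bi f'i f'S f'p b'i b'p b'S.
rewrite !(sum_bool2 _ (s p) (s i)) -/p -/S.
rewrite !flE !eqxx (negbTE PP) (negbTE SP) (negbTE Si) (negbTE Pi) (negbTE PPi).
by rewrite (negbTE iP).
Qed.

Definition fmono f A : F := \prod_(i in A) f i.

Lemma weightE f b s : weight f b s =
  if admissible s then (fmono f (monomers s))%:P * 'X^#|monomers s|
                       * \prod_(i | s i) (1 + (b i)%:P * 'X^2) else 0.
Proof.
case: ifPn => [/forallP ok|/forallPn[i]]; last first.
  rewrite negbK => /andP[s1 s2].
  by rewrite /weight (bigD1 i) //= s1 s2 mul0r.
rewrite /weight /fmono rmorph_prod /= -prodr_const -big_split /=.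
rewrite (big_mkcond (fun i => i \in monomers s)) (big_mkcond (fun i => s i)) -big_split /=.
apply: eq_bigr => i _; have := ok i; rewrite inE /local_weight.
by case: (s (ord_pred i)); case: (s i); rewrite //= ?mulr1 ?mul1r.
Qed.

(** The second elementary symmetric function of the [b i]. *)
Definition half_sq_diff (D : pred I) b : F :=
  ((\sum_(i | D i) b i) ^+ 2 - \sum_(i | D i) b i ^+ 2) / 2%:R.

(** The remainder [q] collects the choices of three or more dominoes, which the
    coefficients of degree at most 4 do not see. *)
Lemma prod_quad (D : pred I) b : exists q : {poly F},
  \prod_(i | D i) (1 + (b i)%:P * 'X^2)
  = 1 + (\sum_(i | D i) b i)%:P * 'X^2 + (half_sq_diff D b)%:P * 'X^4 + q * 'X^6.
Proof.
pose P (s1 s2 : F) (p : {poly F}) := exists q : {poly F},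
  p = 1 + s1%:P * 'X^2 + ((s1 ^+ 2 - s2) / 2%:R)%:P * 'X^4 + q * 'X^6.
rewrite /half_sq_diff -/(P _ _ _); apply: big_rec3.
  by exists 0; rewrite expr0n /= subr0 [0 / _]mul0r !polyC0; ring.
move=> i s1 s2 p _ [q ->].
exists (q + (b i)%:P * ((s1 ^+ 2 - s2) / 2%:R)%:P + (b i)%:P * q * 'X^2).
have -> : ((b i + s1) ^+ 2 - (b i ^+ 2 + s2)) / 2%:R
   = (s1 ^+ 2 - s2) / 2%:R + b i * s1 by field.
by rewrite !polyCD polyCM; ring.
Qed.

Lemma weight_coef3 f b s : admissible s -> (weight f b s)`_3 =
  (if #|monomers s| == 3 then fmono f (monomers s) else 0)
  + (if #|monomers s| == 1%N then fmono f (monomers s) * \sum_(i | s i) b i else 0).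
Proof.
move=> ok; rewrite weightE ok; have [q ->] := prod_quad s b.
rewrite -mulrA coefCM coefXnM; case: #|monomers s| => [|[|[|[|m]]]] /=;
  by rewrite ?(coefD, coefCM, coefXn, coefMXn, coef1) /=
    ?(mulr0, mulr1, addr0, add0r).
Qed.

Lemma weight_coef4 f b s : admissible s -> (weight f b s)`_4 =
  (if #|monomers s| == 4 then fmono f (monomers s) else 0)
  + (if #|monomers s| == 2 then fmono f (monomers s) * \sum_(i | s i) b i else 0)
  + (if #|monomers s| == 0 then half_sq_diff s b else 0).
Proof.
move=> ok; rewrite weightE ok; have [q ->] := prod_quad s b.
rewrite -mulrA coefCM coefXnM; case E: #|monomers s| => [|[|[|[|[|m]]]]] /=;
  rewrite ?(coefD, coefCM, coefXn, coefMXn, coef1) /=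
    ?(mulr0, mulr1, addr0, add0r) //.
move/eqP: E; rewrite cards_eq0 => /eqP ->.
by rewrite /fmono big_set0 mul1r.
Qed.

Lemma coef_dimer_sum f b n : (dimer_sum f b)`_n = \sum_(s | admissible s) (weight f b s)`_n.
Proof.
rewrite /dimer_sum coef_sum (bigID admissible) /= [X in _ + X]big1 ?addr0 // => s ns.
by rewrite weightE (negbTE ns) coef0.
Qed.

Lemma dimer_sum_coef3 f b : (dimer_sum f b)`_3 = \sum_(A in calS l 3) fmono f A
  + \sum_(A in calS l 1) fmono f A * \sum_(i | state_of A i) b i.
Proof.
rewrite coef_dimer_sum (eq_bigr _ (weight_coef3 f b)) big_split /= -!big_mkcondr.
by rewrite (sum_states (fun A _ => fmono f A)) //
  (sum_states (fun A s => fmono f A * \sum_(i | s i) b i)).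
Qed.

Lemma dimer_sum_coef4 f b : odd l -> (dimer_sum f b)`_4 = \sum_(A in calS l 4) fmono f A
  + \sum_(A in calS l 2) fmono f A * \sum_(i | state_of A i) b i
  + (half_sq_diff (fun i => odd i) b + half_sq_diff (fun i => ~~ odd i) b).
Proof.
move=> lo; rewrite coef_dimer_sum (eq_bigr _ (weight_coef4 f b)) !big_split /= -!big_mkcondr.
rewrite (sum_states (fun A _ => fmono f A)) //
  (sum_states (fun A s => fmono f A * \sum_(i | s i) b i)) //.
rewrite alternating_states //; congr (_ + (_ + _)); rewrite /half_sq_diff.
  by congr ((_ ^+ 2 - _) / _); apply: eq_bigl => i; rewrite ffunE.
by congr ((_ ^+ 2 - _) / _); apply: eq_bigl => i; rewrite ffunE.
Qed.
End PartitionFunction.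

Lemma eq_dimer_sum (F : fieldType) l (f f' b b' : 'I_l.+1 -> F) :
  f =1 f' -> b =1 b' -> dimer_sum f b = dimer_sum f' b'.
Proof.
move=> ff bb; apply: eq_bigr => s _; apply: eq_bigr => i _.
by rewrite /local_weight ff bb.
Qed.

Lemma dimer_sum_map (F F' : fieldType) (g : {rmorphism F -> F'}) l (f b : 'I_l.+1 -> F) n :
  g (dimer_sum f b)`_n = (dimer_sum (g \o f) (g \o b))`_n.
Proof.
suff -> : dimer_sum (g \o f) (g \o b) = map_poly g (dimer_sum f b) by rewrite coef_map.
rewrite [in RHS]/dimer_sum rmorph_sum; apply: eq_bigr => s _ /=.
rewrite [in RHS]/weight rmorph_prod; apply: eq_bigr => i _ /=; rewrite /local_weight.
case: (s _); case: (s _) => /=; rewrite ?rmorph0 ?rmorph1 //.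
  by rewrite rmorphD rmorph1 rmorphM /= map_polyC map_polyXn.
by rewrite rmorphM /= map_polyC map_polyX.
Qed.

(** * Dominoes and monomers *)

Section Dominoes.
Context (F : fieldType) (l : nat).
Local Notation I := 'I_l.+1.
Implicit Types (i p x y a : I) (A : {set I}) (f b : I -> F).

Lemma dist_back1 a g : (g <= l)%N -> dist_back [set a] (sh a g) = g.
Proof.
move=> gl; apply: dist_back_uniq => [|u ug]; first by rewrite shK set11.
rewrite step_back_sh ?(ltnW ug) // inE -[X in _ != X](sh0 a) sh_eq //; last first.
  exact: leq_ltn_trans (leq_subr _ _) _.
by rewrite subn_eq0 -ltnNge.
Qed.

Lemma dist_back2 y e g : (g < e <= l)%N -> dist_back [set sh y e; y] (sh y g) = g.
Proof.
move=> /andP[ge el]; apply: dist_back_uniq => [|u ug]; first by rewrite shK set22.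
have ul : (g - u < l.+1)%N by lia.
rewrite step_back_sh ?(ltnW ug) // !inE -[X in _ || (_ == X)](sh0 y) !sh_eq //.
by lia.
Qed.

Lemma sum_image (V : nmodType) (T : finType) (D : pred T) (h : T -> {set I})
    (P : pred {set I}) (X : {set I} -> V) :
  {in D &, injective h} -> (forall A, reflect (exists2 t, D t & A = h t) (P A)) ->
  \sum_(A | P A) X A = \sum_(t | D t) X (h t).
Proof.
move=> hI hP; have -> : \sum_(A | P A) X A = \sum_(A in [set h t | t in D]) X A.
  apply: eq_bigl => A; apply/hP/imsetP => -[t Dt ->]; by exists t.
by rewrite big_imset.
Qed.

Definition monomer1 f p : F := \sum_(1 <= r < l./2.+1) f (sh p (2 * r)).

Definition monomer2 f p : F :=
  \sum_(1 <= s < l./2.+1) \sum_(1 <= r < s.+1)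
    f (sh p (2 * r)) * f (sh p (2 * s + 1)).

(** A single monomer [a] leaves a chain of even length [l], in which the edge at
    [p] carries a domino exactly when [a] is at even positive distance after [p]. *)
Lemma monomer1E f p : ~~ odd l ->
  \sum_(A in calS l 1 | state_of A p) fmono f A = monomer1 f p.
Proof.
move=> le; have lE : l = (2 * l./2)%N by lia.
rewrite /monomer1 big_add1 big_mkord /=.
rewrite (@sum_image _ _ predT (fun r : 'I_l./2 => [set sh p (2 * r.+1)])).
- by apply: eq_bigr => r _; rewrite /fmono big_set1.
- move=> r s _ _ /set1_inj/eqP; have := ltn_ord r; have := ltn_ord s => ? ?.
  rewrite sh_eq; [|lia|lia] => /eqP ?; apply/val_inj => /=; lia.
move=> A; rewrite calSE //; apply: (iffP andP).
  case=> /andP[/cards1P[a ->] _]; rewrite ffunE.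
  have [g gl pE] := sh_surj a p; rewrite pE dist_back1 // => go.
  have hN : ((l.+1 - g)./2.-1 < l./2)%N by lia.
  exists (Ordinal hN) => //=; congr [set _]; rewrite shD.
  by rewrite -[LHS]sh_full; congr (sh _ _); lia.
case=> r _ ->; have rl := ltn_ord r; set a := sh p _.
have pE : p = sh a (l.+1 - 2 * r.+1).
  by rewrite shD -[LHS]sh_full; congr (sh _ _); lia.
rewrite ffunE {1}pE dist_back1; last by lia.
rewrite cards1 eqxx; split; last by lia.
apply/forall_inP => q; rewrite inE => /eqP ->.
by rewrite ord_pred_sh dist_back1.
Qed.

(** Cut the cycle after the domino [{p, p+1}].  The two monomers split the
    remaining path into three even chains: the first monomer is at an even
    distance from [p], the second one at a larger odd distance. *)
Lemma monomer2E f p : odd l ->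
  \sum_(A in calS l 2 | state_of A p) fmono f A = monomer2 f p.
Proof.
move=> lo; have lE : l = (2 * l./2 + 1)%N by lia.
rewrite /monomer2 big_add1 big_mkord /=.
pose h (t : 'I_l./2 * 'I_l./2) := [set sh p (2 * t.2.+1); sh p (2 * t.1.+1 + 1)].
rewrite (@sum_image _ _ (fun t : 'I_l./2 * 'I_l./2 => (t.2 <= t.1)%N) h).
- rewrite -(pair_big_dep predT (fun s r : 'I_l./2 => (r <= s)%N)
    (fun s r => fmono f (h (s, r)))) /=.
  apply: eq_bigr => s _; rewrite big_add1 big_mkord /=.
  rewrite (big_ord_widen l./2 (fun r => f (sh p (2 * r.+1)) * f (sh p (2 * s.+1 + 1)))) //.
  apply: eq_big => [r|r rs]; first by rewrite ltnS.
  rewrite /fmono big_setU1 ?big_set1 //= inE sh_eq; have := ltn_ord s; have := ltn_ord r; lia.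
- move=> [s r] [s' r'] /= _ _ /setP e; rewrite /h /= in e.
  have sl := ltn_ord s; have rl := ltn_ord r.
  have sl' := ltn_ord s'; have rl' := ltn_ord r'.
  have := e (sh p (2 * r.+1)); rewrite !inE eqxx !sh_eq; [|lia..].
  have := e (sh p (2 * s.+1 + 1)); rewrite !inE eqxx orbT !sh_eq; [|lia..].
  move=> e1 e2; congr (_, _); apply/val_inj => /=; lia.
move=> A; rewrite calSE //; apply: (iffP andP).
  case=> /andP[/cards2P[x0 [y0 [xy0 AE]]] /forall_inP gA]; rewrite ffunE => go.
  have A0 : A != set0 by rewrite AE; apply/set0Pn; exists x0; rewrite set21.
  have [gN yA ug] := dist_back_spec p A0; set g := dist_back A p in go gN yA ug.
  set y := step_back g p in yA; have pE : p = sh y g by rewrite step_backK.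
  have [x xy Axy] : exists2 x, x != y & A = [set x; y].
    move: yA; rewrite AE !inE => /orP[]/eqP->; last by exists x0.
    by exists y0; rewrite 1?eq_sym // setUC.
  have [e eN xE] := sh_surj y x.
  have e0 : (0 < e)%N by rewrite lt0n; apply: contra xy => /eqP e0; rewrite xE e0 sh0.
  have ge : (g < e)%N.
    rewrite ltnNge; apply/negP => eg; have := ug (g - e)%N.
    rewrite pE step_back_sh ?leq_subr // subKn // -xE Axy set21 => /(_ _)/negP[] //; lia.
  have : ~~ odd (dist_back A (ord_pred x)) by apply: gA; rewrite Axy set21.
  have -> : ord_pred x = sh y e.-1.
    by rewrite xE; case: (e) e0 => // e' _; rewrite -shS ordSK.
  rewrite Axy xE dist_back2; last by lia.
  move=> eo; have sl : ((l.+1 - g)./2.-1 < l./2)%N by lia.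
  have rl : ((e - g)./2.-1 < l./2)%N by lia.
  exists (Ordinal sl, Ordinal rl); rewrite /h /=; first by lia.
  rewrite pE !shD; congr [set _; _]; first by congr (sh _ _); lia.
  by rewrite -[LHS]sh_full; congr (sh _ _); lia.
case=> -[s r] /= rs ->; rewrite /h /=.
have sl := ltn_ord s; have rl := ltn_ord r.
set x := sh p _; set y := sh p _.
pose g := (l.+1 - (2 * s.+1 + 1))%N; pose e := (g + 2 * r.+1)%N.
have pE : p = sh y g by rewrite shD -[LHS]sh_full; congr (sh _ _); lia.
have xE : x = sh y e by rewrite /e -shD -pE.
have yE : y = sh x (l.+1 - e) by rewrite xE shD -[LHS]sh_full; congr (sh _ _); lia.
have xy : x != y by rewrite sh_eq; lia.
rewrite cards2 xy eqxx; split; last first.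
  by rewrite ffunE {1}pE xE dist_back2; lia.
apply/forall_inP => q; rewrite !inE => /orP[]/eqP->.
  have -> : ord_pred x = sh y e.-1.
    have : (0 < e)%N by lia.
    by rewrite xE; case: (e) => // e' _; rewrite -shS ordSK.
  by rewrite xE dist_back2; lia.
have -> : ord_pred y = sh x (l.+1 - e).-1.
  have : (0 < l.+1 - e)%N by lia.
  by rewrite yE; case: (l.+1 - e)%N => // e' _; rewrite -shS ordSK.
by rewrite setUC {1}yE dist_back2; lia.
Qed.

(** The part of the dimer sum linear in [b], collected according to the domino
    instead of the monomer set. *)
Lemma domino_sum d f b :
  \sum_(A in calS l d) fmono f A * \sum_(i | state_of A i) b i
  = \sum_p b p * \sum_(A in calS l d | state_of A p) fmono f A.
Proof.
under eq_bigr do rewrite mulr_sumr.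
rewrite (exchange_big_dep predT) //=; apply: eq_bigr => p _.
by rewrite mulr_sumr; apply: eq_bigr => A _; rewrite mulrC.
Qed.

Hypothesis two_neq0 : 2%:R != 0 :> F.

Lemma dimer_sum_linear3 f b : ~~ odd l ->
  (dimer_sum f b)`_3 = (dimer_sum f (fun=> 0))`_3 + \sum_p b p * monomer1 f p.
Proof.
move=> le; rewrite !dimer_sum_coef3 // !domino_sum [X in _ = _ + X + _]big1 ?addr0.
  by congr (_ + _); apply: eq_bigr => p _; rewrite monomer1E.
by move=> p _; rewrite mul0r.
Qed.

Lemma half_sq_diff0 (D : pred I) : half_sq_diff D (fun=> 0 : F) = 0.
Proof.
by rewrite /half_sq_diff !big1 ?expr0n ?subrr ?mul0r // => i _; rewrite expr0n.
Qed.

Lemma dimer_sum_linear4 f b : odd l ->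
  (dimer_sum f b)`_4 = (dimer_sum f (fun=> 0))`_4 + \sum_p b p * monomer2 f p
    + (half_sq_diff (fun i => odd i) b + half_sq_diff (fun i => ~~ odd i) b).
Proof.
move=> lo; rewrite !dimer_sum_coef4 // !domino_sum !half_sq_diff0 !addr0; congr (_ + _).
rewrite [X in _ = _ + X + _]big1 ?addr0.
  by congr (_ + _); apply: eq_bigr => p _; rewrite monomer2E.
by move=> p _; rewrite mul0r.
Qed.
End Dominoes.

Section Transport.
Context (F F' : fieldType) (l : nat).
Implicit Types (f : 'I_l.+1 -> F).

Lemma rmorph_monomer1 (g : {rmorphism F -> F'}) f p :
  g (monomer1 f p) = monomer1 (g \o f) p.
Proof. exact: rmorph_sum. Qed.

Lemma rmorph_monomer2 (g : {rmorphism F -> F'}) f p :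
  g (monomer2 f p) = monomer2 (g \o f) p.
Proof.
rewrite rmorph_sum; apply: eq_bigr => s _; rewrite rmorph_sum; apply: eq_bigr => r _.
exact: rmorphM.
Qed.

Lemma eq_monomer1 f f' p : f =1 f' -> monomer1 f p = monomer1 f' p.
Proof. by move=> ff; apply: eq_bigr => r _. Qed.

Lemma eq_monomer2 f f' p : f =1 f' -> monomer2 f p = monomer2 f' p.
Proof.
by move=> ff; apply: eq_bigr => s _; apply: eq_bigr => r _; rewrite !ff.
Qed.

Lemma monomer1_shift f p : monomer1 (f \o (@ordS _)) p = monomer1 f (ordS p).
Proof. by apply: eq_bigr => r _ /=; rewrite shS shSl. Qed.

Lemma monomer2_shift f p : monomer2 (f \o (@ordS _)) p = monomer2 f (ordS p).
Proof.
by apply: eq_bigr => s _; apply: eq_bigr => r _ /=; rewrite !shS !shSl.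
Qed.
End Transport.

Section ChiBeta.
Context (K : fieldType) (l : nat).
Local Notation I := 'I_l.+1.

(** The weight of the domino [{p, p+1}]: pairing the terms of [chi_chain] along
    an even chain turns it into the sum of these differences over the dominoes. *)
Definition beta (p : I) := varpi K p - varpi K (ordS p).

Lemma chi_beta d (A : {set I}) : (0 < d)%N -> A \in calS l d ->
  chi K (~: A) = \sum_(p | state_of A p) beta p.
Proof.
move=> d0; rewrite calSE // => /andP[/eqP cA gA].
have A0 : A != set0 by rewrite -card_gt0 cA.
rewrite chiE // (bigID (fun y => odd (dist_back A y))) /= /beta sumrB; congr (_ + _).
  apply: eq_big => [y|y /andP[_ yo]].
    by rewrite ffunE andb_idl //; apply: contraL => yA; rewrite dist_back_in.
  by rewrite -signr_odd -[odd _]negbK -oddS prednK ?yo ?mul1r //; case: dist_back yo.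
rewrite -sumrN [RHS](reindex_inj (can_inj (@ord_predK l.+1))) /=.
apply: eq_big => [y|y /andP[yA ye]]; first by rewrite even_gaps_succ // ffunE.
rewrite ord_predK -signr_odd -[odd _]negbK -oddS prednK.
  by rewrite ye expr1 mulN1r.
by rewrite dist_back_notin.
Qed.
End ChiBeta.

(** * Sums over a parity class *)

Section ParitySums.
Context {F : comNzRingType} {l : nat}.
Local Notation I := 'I_l.+1.
Implicit Types (u v : I -> F) (i j m : I).

Definition parity_sum u j : F := \sum_(r < l./2.+1) u (sh j (2 * r)).

Lemma parity_sumD u v j : parity_sum (fun i => u i + v i) j = parity_sum u j + parity_sum v j.
Proof. exact: big_split. Qed.

Lemma parity_sumZ c u j : parity_sum (fun i => c * u i) j = c * parity_sum u j.
Proof. by rewrite /parity_sum mulr_sumr. Qed.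

Lemma eq_parity_sum u v j : u =1 v -> parity_sum u j = parity_sum v j.
Proof. by move=> uv; apply: eq_bigr => r _; rewrite uv. Qed.

Lemma parity_sum_shift u j : parity_sum (fun i => u (ordS i)) j = parity_sum u (ordS j).
Proof. by apply: eq_bigr => r _; rewrite shS shSl. Qed.

Definition indic m i : F := (i == m)%:R.

Lemma indic_total m : \sum_i indic m i = 1.
Proof. by rewrite (bigD1 m) //= /indic eqxx big1 ?addr0 // => i /negbTE->. Qed.

Hypothesis l_odd : odd l.

(** The cycle has an even number of nodes, so the two parity classes are well
    defined and exhaust it. *)
Lemma parity_sum_total u j : parity_sum u j + parity_sum u (ordS j) = \sum_i u i.
Proof.
have shbij : bijective (fun i : I => sh j i).
  by apply: injF_bij => a b /eqP; rewrite sh_eq // => /eqP/val_inj.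
rewrite (reindex _ (onW_bij _ shbij)) /=.
have lE : l.+1 = (2 * l./2.+1)%N by lia.
rewrite -(big_mkord predT (fun r => u (sh j r))) [X in index_iota _ X]lE /parity_sum
  -big_split /=.
elim: (l./2.+1) => [|n IH]; first by rewrite big_ord0 big_nil.
rewrite big_ord_recr IH mulnS !big_nat_recr //= -addrA; congr (_ + (_ + _)).
by rewrite shSl.
Qed.

Lemma parity_sum_period u j : parity_sum u (ordS (ordS j)) = parity_sum u j.
Proof.
apply: (addrI (parity_sum u (ordS j))).
by rewrite parity_sum_total addrC parity_sum_total.
Qed.

Lemma parity_sum_indic m : parity_sum (indic m) m = 1.
Proof.
rewrite /parity_sum big_ord_recl muln0 sh0 /indic eqxx big1 ?addr0 // => r _ /=.
rewrite -[X in _ == X]sh0 sh_eq //; have := ltn_ord r; rewrite /bump; lia.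
Qed.

Lemma parity_sum_indic_shift m j :
  parity_sum (indic (ordS m)) (ordS j) = parity_sum (indic m) j.
Proof.
rewrite -parity_sum_shift; apply: eq_parity_sum => i.
by rewrite /indic ordS_eq.
Qed.

Lemma parity_sum_indic_succ m : parity_sum (indic (ordS m)) m = 0.
Proof.
apply: (addIr (parity_sum (indic (ordS m)) (ordS m))).
by rewrite parity_sum_total parity_sum_indic add0r indic_total.
Qed.

(** The two neighbours of a node have the same parity, so opposite changes of
    them leave every parity sum alone. *)
Lemma parity_sum_indic_next m j :
  parity_sum (indic (ordS m)) j = parity_sum (indic (ord_pred m)) j.
Proof. by rewrite -(parity_sum_period _ j) -{1}[m]ord_predK !parity_sum_indic_shift. Qed.

Lemma parity_sum_odd u : \sum_(p : I | odd p) u p = parity_sum u (ordS ord0).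
Proof.
rewrite big_mkcond -(parity_sum_total _ ord0) [X in X + _]big1 ?add0r => [|r _].
  apply: eq_bigr => r _; rewrite shSl /= add0n modn_small ?oddS ?mul2n ?odd_double //.
  by have := ltn_ord r; lia.
rewrite /= add0n modn_small ?mul2n ?odd_double //.
by have := ltn_ord r; lia.
Qed.
End ParitySums.

Lemma rmorph_parity_sum (F F' : comNzRingType) l (g : {rmorphism F -> F'}) (u : 'I_l.+1 -> F) j :
  g (parity_sum u j) = parity_sum (g \o u) j.
Proof. exact: rmorph_sum. Qed.

(** * Derivations commuting with a morphism *)

Section CommutingDerivation.
Context (L : fieldType) (d : L -> L).
Hypothesis dD : {morph d : x y / x + y}.
Hypothesis dM : forall x y, d (x * y) = d x * y + x * d y.

Lemma derivation_one : d 1 = 0.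
Proof. by apply: (addIr (d 1)); rewrite add0r -{3}[1]mulr1 dM mulr1 mul1r. Qed.

Lemma derivation_opp x : d (- x) = - d x.
Proof.
have d0 : d 0 = 0 by apply: (addIr (d 0)); rewrite -dD !add0r.
by apply: (addIr (d x)); rewrite -dD !addNr.
Qed.

Lemma derivation_inv x : x != 0 -> d x^-1 = - d x / x ^+ 2.
Proof.
move=> x0; have : d (x * x^-1) = 0 by rewrite divff // derivation_one.
rewrite dM => /eqP; rewrite addrC addr_eq0 => /eqP e.
by apply: (mulfI x0); rewrite e; field.
Qed.

Variable g : {rmorphism L -> L}.

Lemma commute_add x y : g (d x) = d (g x) -> g (d y) = d (g y) ->
  g (d (x + y)) = d (g (x + y)).
Proof. by move=> ex ey; rewrite dD !rmorphD /= ex ey dD. Qed.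

Lemma commute_mul x y : g (d x) = d (g x) -> g (d y) = d (g y) ->
  g (d (x * y)) = d (g (x * y)).
Proof. by move=> ex ey; rewrite dM rmorphD !rmorphM /= ex ey dM. Qed.

Lemma commute_inv x : x != 0 -> g (d x) = d (g x) -> g (d x^-1) = d (g x^-1).
Proof.
move=> x0 ex; rewrite derivation_inv // fmorphV derivation_inv ?fmorph_eq0 //.
by rewrite fmorph_div rmorphN rmorphXn /= ex.
Qed.
End CommutingDerivation.

(** * Monomer sums under shifts and under a kick of two neighbours *)

Section Differences.
Context {F : fieldType} {l : nat}.
Local Notation I := 'I_l.+1.
Local Notation n := (l./2).
Implicit Types (i j : I) (f g : I -> F).

Lemma sh_pred j r : sh (ord_pred j) r.+1 = sh j r.
Proof. by rewrite -shSl ord_predK. Qed.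

Lemma parity_sum_recl f j : parity_sum f j = f j + \sum_(1 <= r < n.+1) f (sh j (2 * r)).
Proof. by rewrite /parity_sum -(big_mkord predT (fun r => f (sh j (2 * r)))) big_ltn // sh0. Qed.

Lemma monomer1_pred f j :
  monomer1 f (ord_pred j) = \sum_(0 <= r < n) f (sh j (2 * r + 1)).
Proof.
rewrite /monomer1 big_add1; apply: eq_big_nat => r _.
by rewrite -[in RHS]sh_pred; congr (f (sh _ _)); lia.
Qed.

Lemma monomer2_pred f j : monomer2 f (ord_pred j) =
  \sum_(1 <= s < n.+1) f (sh j (2 * s)) * \sum_(0 <= r < s) f (sh j (2 * r + 1)).
Proof.
apply: eq_big_nat => s _; rewrite big_add1 mulr_sumr; apply: eq_big_nat => r _.
rewrite mulrC -[in RHS](sh_pred j (2 * s)) -[in RHS](sh_pred j (2 * r + 1)).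
by congr (f (sh _ _) * f (sh _ _)); lia.
Qed.

Lemma monomer2F f j : monomer2 f j =
  \sum_(1 <= s < n.+1) f (sh j (2 * s + 1)) * \sum_(1 <= r < s.+1) f (sh j (2 * r)).
Proof. by apply: eq_big_nat => s _; rewrite mulr_sumr; apply: eq_bigr => r _; rewrite mulrC. Qed.

(** The two sums differ by a shift of the index by one step of length 2. *)
Lemma monomer1_step f j : ~~ odd l ->
  monomer1 f (ord_pred j) - monomer1 f (ordS j) = f (ordS j) - f j.
Proof.
move=> le; rewrite monomer1_pred /monomer1 big_add1 /=.
pose u r := f (sh j (2 * r + 1)).
have -> : \sum_(0 <= r < n) f (sh (ordS j) (2 * r.+1)) = \sum_(0 <= r < n) u r.+1.
  by apply: eq_bigr => r _; rewrite shSl /u addn1.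
have -> : f (ordS j) = u 0%N by rewrite /u ordS_sh.
have -> : f j = u n by rewrite /u -{1}[j]sh_full; congr (f (sh j _)); lia.
apply/eqP; rewrite subr_eq addrAC eq_sym subr_eq -(big_nat_recr n) //=.
by rewrite -(big_nat_recl n 0 u) // eqxx.
Qed.

(** Both double sums run over an even node and an odd node in a window of the
    cycle; the windows differ by one step of length 2, which leaves the terms with
    an index at the ends, [j] or [j+1].  At [s = n+1] the node [sh j (2 * s)] is
    [j] again. *)
Lemma monomer2_step f j : odd l ->
  monomer2 f (ord_pred j) - monomer2 f (ordS j)
  = f (ordS j) * parity_sum f j - f j * parity_sum f (ordS j).
Proof.
move=> lo; rewrite monomer2_pred monomer2F.
pose b s := f (sh j (2 * s)); pose c s := \sum_(0 <= r < s) f (sh j (2 * r + 1)).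
have a0E : f (ordS j) = c 1%N by rewrite /c big_nat1 ordS_sh.
have b0E : f j = b n.+1 by rewrite /b -{1}[j]sh_full; congr (f (sh j _)); lia.
have psE : parity_sum f (ordS j) = c n.+1.
  by rewrite /parity_sum /c big_mkord; apply: eq_bigr => r _; rewrite shSl addn1.
have -> : \sum_(1 <= s < n.+1) f (sh (ordS j) (2 * s + 1)) *
      \sum_(1 <= r < s.+1) f (sh (ordS j) (2 * r))
   = \sum_(1 <= s < n.+1) b s.+1 * (c s.+1 - c 1%N).
  apply: eq_big_nat => s _; congr (_ * _).
    by rewrite shSl /b; congr (f (sh _ _)); lia.
  rewrite /c big_nat1 [X in _ = X - _]big_ltn // addrAC subrr add0r.
  by apply: eq_big_nat => r _; rewrite shSl addn1.
have -> : \sum_(1 <= s < n.+1) b s.+1 * (c s.+1 - c 1%N)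
   = \sum_(1 <= s < n.+2) b s * (c s - c 1%N).
  by rewrite [RHS]big_ltn // subrr mulr0 add0r [RHS]big_add1.
rewrite [X in _ - X]big_nat_recr //= opprD addrA -sumrB.
rewrite (eq_bigr (fun s => b s * c 1%N)) => [|s _]; last by rewrite -/(b s) -/(c s); ring.
rewrite parity_sum_recl -/(b _) -mulr_suml a0E psE b0E; ring.
Qed.

Hypothesis l_gt1 : (1 < l)%N.

(** The effect of the reflection at [j] on the variables [f], with
    [e = alpha_j / f_j]. *)
Definition kick e j f i := f i + e * (indic (ordS j) i - indic (ord_pred j) i).

Lemma kick_sh e f j r : (r <= l)%N ->
  kick e j f (sh j r) = f (sh j r) + e * ((r == 1%N)%:R - (r == l)%:R).
Proof.
by move=> rl; rewrite /kick /indic [in ordS j]ordS_sh (ord_pred_sh j) !sh_eq //; apply: ltnW.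
Qed.

(** Of the two neighbours of [j], only [j+1] occurs in the first sum and only
    [j-1] in the second one; the kicks are opposite and so are the signs. *)
Lemma monomer1_kick e j f : ~~ odd l ->
  monomer1 (kick e j f) (ord_pred j) - monomer1 (kick e j f) j
  = monomer1 f (ord_pred j) - monomer1 f j + 2%:R * e.
Proof.
move=> le; rewrite !monomer1_pred.
have -> : \sum_(0 <= r < n) kick e j f (sh j (2 * r + 1))
   = \sum_(0 <= r < n) f (sh j (2 * r + 1)) + e.
  have n0 : (0 < n)%N by lia.
  rewrite [LHS]big_ltn // [X in X + e]big_ltn // kick_sh; last by lia.
  have -> : (2 * 0 + 1 == l)%N = false by lia.
  rewrite addrAC subr0 mulr1; congr (_ + _ + _); apply: eq_big_nat => r rn.
  rewrite kick_sh; last by lia.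
  have -> : (2 * r + 1 == 1)%N = false by lia.
  have -> : (2 * r + 1 == l)%N = false by lia.
  by rewrite subrr mulr0 addr0.
have -> : monomer1 (kick e j f) j = monomer1 f j - e.
  have nE : (n = n.-1.+1)%N by lia.
  rewrite /monomer1 nE [LHS]big_nat_recr // [X in X - e]big_nat_recr //= kick_sh; last by lia.
  have -> : (2 * n.-1.+1 == 1)%N = false by lia.
  have -> : (2 * n.-1.+1 == l)%N by lia.
  rewrite sub0r mulrN1 addrA; congr (_ + _ - _); apply: eq_big_nat => r rn.
  rewrite kick_sh; last by lia.
  have -> : (2 * r == 1)%N = false by lia.
  have -> : (2 * r == l)%N = false by lia.
  by rewrite subrr mulr0 addr0.
ring.
Qed.

(** As for one monomer: each double sum sees one neighbour of [j], and in both the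
    coefficient of that neighbour is the sum of the [f] over the nodes other than
    [j] in the parity class of [j]. *)
Lemma monomer2_kick e j f : odd l ->
  monomer2 (kick e j f) (ord_pred j) - monomer2 (kick e j f) j
  = monomer2 f (ord_pred j) - monomer2 f j + 2%:R * e * (parity_sum f j - f j).
Proof.
move=> lo; rewrite parity_sum_recl [f j + _]addrC addrK !monomer2_pred !monomer2F.
set G := \sum_(1 <= r < n.+1) f (sh j (2 * r)).
have bE s : (0 < s < n.+1)%N -> kick e j f (sh j (2 * s)) = f (sh j (2 * s)).
  move=> sn; rewrite kick_sh; last by lia.
  have -> : (2 * s == 1)%N = false by lia.
  have -> : (2 * s == l)%N = false by lia.
  by rewrite subrr mulr0 addr0.
have aE s : (0 < s < n)%N -> kick e j f (sh j (2 * s + 1)) = f (sh j (2 * s + 1)).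
  move=> sn; rewrite kick_sh; last by lia.
  have -> : (2 * s + 1 == 1)%N = false by lia.
  have -> : (2 * s + 1 == l)%N = false by lia.
  by rewrite subrr mulr0 addr0.
have a0E : kick e j f (sh j (2 * 0 + 1)) = f (sh j (2 * 0 + 1)) + e.
  rewrite kick_sh; last by lia.
  have -> : (2 * 0 + 1 == l)%N = false by lia.
  by rewrite subr0 mulr1.
have anE : kick e j f (sh j (2 * n + 1)) = f (sh j (2 * n + 1)) - e.
  rewrite kick_sh; last by lia.
  have -> : (2 * n + 1 == 1)%N = false by lia.
  have -> : (2 * n + 1 == l)%N by lia.
  by rewrite sub0r mulrN1.
have -> : \sum_(1 <= s < n.+1) kick e j f (sh j (2 * s)) *
     \sum_(0 <= r < s) kick e j f (sh j (2 * r + 1))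
   = \sum_(1 <= s < n.+1) f (sh j (2 * s)) * \sum_(0 <= r < s) f (sh j (2 * r + 1))
     + e * G.
  rewrite mulr_sumr -big_split; apply: eq_big_nat => s sn /=; rewrite bE //.
  case/andP: sn => s0 sn; rewrite [X in _ * X = _]big_ltn // a0E.
  rewrite [X in _ = _ * X + _]big_ltn //.
  rewrite (eq_big_nat _ _ (F2 := fun r => f (sh j (2 * r + 1)))); first by ring.
  by move=> r rs; apply: aE; lia.
have nE : (n = n.-1.+1)%N by lia.
have -> : \sum_(1 <= s < n.+1) kick e j f (sh j (2 * s + 1)) *
     \sum_(1 <= r < s.+1) kick e j f (sh j (2 * r))
   = \sum_(1 <= s < n.+1) f (sh j (2 * s + 1)) * \sum_(1 <= r < s.+1) f (sh j (2 * r))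
     - e * G.
  have inE s : (s < n.+1)%N -> \sum_(1 <= r < s.+1) kick e j f (sh j (2 * r))
      = \sum_(1 <= r < s.+1) f (sh j (2 * r)).
    by move=> sn; apply: eq_big_nat => r rs; apply: bE; lia.
  rewrite big_nat_recr /=; last by lia.
  rewrite [X in _ = X - _]big_nat_recr /=; last by lia.
  rewrite anE inE // -/G (eq_big_nat _ _ (F2 := fun s =>
    f (sh j (2 * s + 1)) * \sum_(1 <= r < s.+1) f (sh j (2 * r)))); first by ring.
  by move=> s sn; rewrite aE ?inE //; lia.
ring.
Qed.
End Differences.

(** * Identities in a field *)

Lemma shifted_square (L : fieldType) (k a : L) : 2%:R != 0 :> L ->
  (k / 2%:R - a / 2%:R) ^+ 2 - (a / 2%:R) ^+ 2 = k ^+ 2 / 4%:R - k / 2%:R * a.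
Proof.
move=> two0; have four0 : 4%:R != 0 :> L by rewrite (natrM _ 2 2) mulf_neq0.
by field; rewrite ?two0 ?four0.
Qed.

Lemma second_diff_identity (L : fieldType) (k a b s t c : L) : 2%:R != 0 :> L ->
  b = k - a -> k * (s - t + (k / 2%:R - a)) =
  k * s - c + (k ^+ 2 / 4%:R - k / 2%:R * a) - (k * t - c + (k ^+ 2 / 4%:R - k / 2%:R * b)).
Proof.
move=> two0 ->; have four0 : 4%:R != 0 :> L by rewrite (natrM _ 2 2) mulf_neq0.
by field; rewrite ?two0 ?four0.
Qed.

Lemma step_identity (L : fieldType) (k a b p q r : L) : 2%:R != 0 :> L ->
  a + b = k -> p - q + (k / 2%:R - a) + (q - r + (k / 2%:R - b)) = p - r.
Proof. by move=> two0 <-; field. Qed.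

Lemma kick_identity (L : fieldType) (x y a p c q : L) : y != 0 ->
  x + 2%:R * (a / y) * (p - y) + (c - (q - 2%:R * a))
  = x + (c - q) + 2%:R * (a / y) * p.
Proof. by move=> y0; field. Qed.

Lemma diag_identity (L : fieldType) (k d p q x y e g : L) : 2%:R != 0 :> L ->
  k * d = 2%:R * x - p - q -> k * (d + 2%:R * e * g) = 2%:R * y - p - q ->
  y = x + k * (e * g).
Proof.
move=> two0 e1; rewrite mulrDr e1 => e2; apply: (mulfI two0).
have -> : 2%:R * y = (2%:R * y - p - q) + p + q by ring.
by rewrite -e2; ring.
Qed.

Lemma neighbour_identity (L : fieldType) (k d d' x p q g : L) : k != 0 ->
  k * d = 2%:R * x - p - q -> k * d' = 2%:R * x - (p + k * g) - q -> d' = d - g.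
Proof.
by move=> k0 e1 e2; apply: (mulfI k0); rewrite e2 mulrBr e1; ring.
Qed.

Lemma reflect_self_identity (L : fieldType) (x d a g : L) : x != 0 ->
  x * (d + 2%:R * (a / x) * g) + - a * g = x * d + a * g.
Proof. by move=> x0; field. Qed.

Lemma reflect_succ_identity (L : fieldType) (x y d e a b g g' : L) : x != 0 ->
  d + e = y * g - x * g' ->
  (y + a / x) * (e - a / x * g) + (b + a) * g'
  = y * e + b * g' + - (a * (x * d + a * g) / x ^+ 2).
Proof.
move=> x0 /eqP; rewrite addrC eq_sym subr_eq eq_sym => /eqP de.
have -> : e = y * g - x * g' - d by rewrite -de; ring.
by field.
Qed.

Lemma reflect_pred_identity (L : fieldType) (x y d e a b g g' : L) : x != 0 ->
  e + d = x * g' - y * g ->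
  (y - a / x) * (e - a / x * g) + (b + a) * g'
  = y * e + b * g' - - (a * (x * d + a * g) / x ^+ 2).
Proof.
move=> x0 de; have -> : e = x * g' - y * g - d by rewrite -de; ring.
by field.
Qed.

Lemma reflect_tau_identity (L : fieldType) (p t q x k hp ht hq d a g : L) :
  x != 0 -> t != 0 -> k != 0 -> k * d = 2%:R * ht - hp - hq ->
  (ht + k * (a / x * g)) * (p * q / t * x) / k =
  ((hp * p / k * q + p * (hq * q / k)) / t + p * q * (- (ht * t / k) / t ^+ 2)) * x
    + p * q / t * (x * d + a * g).
Proof.
move=> x0 t0 k0 e; have -> : d = (2%:R * ht - hp - hq) / k by rewrite -e mulrC mulKf.
by field; rewrite ?x0 ?t0 ?k0.
Qed.

(** * Automorphisms of the field of rational functions *)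

Section Generators.
Context {K : fieldType} {l : nat}.
Local Notation I := 'I_l.+1.
Local Notation F := (ratfun K l).
Local Notation rot := (@pi_ K l).
Local Notation s_ := (@s_ K l).

Lemma ratfun_ind (Q : F -> Prop) : (forall c, Q (rcst c)) ->
  (forall j, Q (alpha K j)) -> (forall j, Q (f_ K j)) -> (forall j, Q (tau K j)) ->
  (forall x y, Q x -> Q y -> Q (x + y)) -> (forall x y, Q x -> Q y -> Q (x * y)) ->
  (forall x, x != 0 -> Q x -> Q x^-1) -> forall x, Q x.
Proof.
move=> Qc Qa Qf Qt QD QM QV x.
have Qp (p : {mpoly K[nvars l]}) : Q (@FracField.tofrac _ p).
  apply: (pind (Q := fun p => Q (@FracField.tofrac _ p))) p =>
    [c|i|p q Qp Qq|p q Qp Qq]; first exact: Qc.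
  - by apply: (varP (Q := fun i => Q (rvar i))) i => j; [apply: Qa|apply: Qf|apply: Qt].
  - by rewrite tofracD; apply: QD.
  - by rewrite tofracM; apply: QM.
have [p [q [q0 ->]]] := rfracP x.
by apply: QM (Qp p) (QV _ _ (Qp q)); rewrite tofrac_eq0.
Qed.

Lemma rmorph_eq (g g' : {rmorphism F -> F}) : (forall c, g (rcst c) = g' (rcst c)) ->
  (forall j, g (alpha K j) = g' (alpha K j)) -> (forall j, g (f_ K j) = g' (f_ K j)) ->
  (forall j, g (tau K j) = g' (tau K j)) -> g =1 g'.
Proof.
move=> gc ga gf gt; apply: ratfun_ind => // [x y ex ey|x y ex ey|x _ ex].
- by rewrite !rmorphD /= ex ey.
- by rewrite !rmorphM /= ex ey.
- by rewrite !fmorphV /= ex.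
Qed.

Lemma der_commute (g : {rmorphism F -> F}) : (forall c, g (rcst c) = rcst c) ->
  (forall j, g (der (alpha K j)) = der (g (alpha K j))) ->
  (forall j, g (der (f_ K j)) = der (g (f_ K j))) ->
  (forall j, g (der (tau K j)) = der (g (tau K j))) -> forall x, g (der x) = der (g x).
Proof.
move=> gc ga gf gt; apply: ratfun_ind => // [c|x y|x y|x].
- by rewrite gc der_cst rmorph0.
- exact: commute_add (@der_add K l) g x y.
- exact: commute_mul (@der_mul K l) g x y.
- exact: commute_inv (@der_mul K l) g x.
Qed.

HB.instance Definition _ := GRing.isZmodMorphism.Build F F (@pi_ K l) (@pi_zmod_morphism K l).
HB.instance Definition _ := GRing.isMonoidMorphism.Build F F (@pi_ K l) (@pi_monoid_morphism K l).

Lemma pi_k : rot (k_ K l) = k_ K l.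
Proof.
rewrite /k_ rmorph_sum /= [RHS](reindex_inj (can_inj (@ordSK l.+1))).
by apply: eq_bigr => j _; rewrite pi_alpha.
Qed.

(** The [h_ K j] are iterates along [0, ..., l]; periodicity closes the cycle,
    so that [pi_] also maps the last one to the first one. *)
Lemma iter_pi_full (x : F) : iter l.+1 rot x = x.
Proof.
have gen (v : I -> F) : (forall j, rot (v j) = v (ordS j)) ->
    forall j, iter l.+1 rot (v j) = v j.
  move=> vE j; have -> n : iter n rot (v j) = v (sh j n).
    by rewrite sh_iter; elim: n => //= n ->; rewrite vE.
  by rewrite sh_full.
elim/ratfun_ind: x => [c||||x y|x y|x _].
- have -> n : iter n rot (rcst c) = rcst c.
    by elim: n => //= n ->; rewrite pi_cst.
  by [].
- exact: gen (@pi_alpha K l).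
- exact: gen (@pi_f K l).
- exact: gen (@pi_tau K l).
- have -> n : iter n rot (x + y) = iter n rot x + iter n rot y.
    by elim: n => //= n ->; rewrite rmorphD.
  by move=> -> ->.
- have -> n : iter n rot (x * y) = iter n rot x * iter n rot y.
    by elim: n => //= n ->; rewrite rmorphM.
  by move=> -> ->.
- have -> n : iter n rot x^-1 = (iter n rot x)^-1.
    by elim: n => //= n ->; rewrite fmorphV.
  by move=> ->.
Qed.

Lemma h_succ (j : I) : h_ K (ordS j) = rot (h_ K j).
Proof.
rewrite /h_ -iterS [nat_of_ord (ordS j)]/=.
have := ltn_ord j; rewrite leq_eqVlt => /orP[/eqP[->]|jl].
  by rewrite modnn iter_pi_full.
by rewrite modn_small.
Qed.

Lemma ordS_ind (Q : I -> Prop) : Q ord0 -> (forall j, Q j -> Q (ordS j)) -> forall j, Q j.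
Proof.
move=> Q0 QS j; have [r _ ->] := sh_surj ord0 j.
by rewrite sh_iter; elim: r => //= r; apply: QS.
Qed.

Section Reflection.
Hypothesis l_gt1 : (1 < l)%N.

HB.instance Definition _ (i : I) :=
  GRing.isZmodMorphism.Build F F (s_ i) (@s_zmod_morphism K l l_gt1 i).
HB.instance Definition _ (i : I) :=
  GRing.isMonoidMorphism.Build F F (s_ i) (@s_monoid_morphism K l l_gt1 i).

Lemma s_alpha_indic (i j : I) : s_ i (alpha K j)
  = alpha K j + alpha K i * (indic (ordS i) j + indic (ord_pred i) j - 2%:R * indic i j).
Proof.
rewrite s_alpha // /indic; have [->|ji] := eqVneq j i.
  rewrite [i == ordS i]eq_sym [i == ord_pred i]eq_sym.
  by rewrite (negbTE (ordS_neq l_gt1 i)) (negbTE (ord_pred_neq l_gt1 i)) /=; ring.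
have [->|jS] := eqVneq j (ordS i).
  by rewrite (negbTE (ordS_neq_pred l_gt1 i)) /=; ring.
by case: (j == ord_pred i) => /=; ring.
Qed.

Lemma s_f_indic (i j : I) : s_ i (f_ K j)
  = f_ K j + alpha K i / f_ K i * (indic (ordS i) j - indic (ord_pred i) j).
Proof.
rewrite s_f // /indic; have [->|jS] := eqVneq j (ordS i).
  by rewrite (negbTE (ordS_neq_pred l_gt1 i)) /=; ring.
by case: (j == ord_pred i) => /=; ring.
Qed.

Lemma s_k (i : I) : s_ i (k_ K l) = k_ K l.
Proof.
rewrite /k_ rmorph_sum /= (eq_bigr _ (fun j _ => s_alpha_indic i j)) big_split /=.
rewrite -mulr_sumr sumrB big_split /= -mulr_sumr !indic_total; ring.
Qed.

(** Lets statements about one reflection be moved around the cycle. *)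
Lemma s_pi (i : I) x : s_ (ordS i) (rot x) = rot (s_ i x) :> F.
Proof.
have Spred (j : I) : (ordS j == i) = (j == ord_pred i).
  by rewrite -[RHS]ordS_eq ord_predK.
pose g1 : {rmorphism F -> F} := s_ (ordS i) \o rot.
pose g2 : {rmorphism F -> F} := rot \o s_ i.
apply: (rmorph_eq (g := g1) (g' := g2)) => [c|j|j|j] /=.
- by rewrite pi_cst !s_cst // pi_cst.
- rewrite pi_alpha !s_alpha //; rewrite !ordS_eq.
  rewrite ordSK Spred.
  by do 2?[case: ifP => _]; rewrite ?rmorphN ?rmorphD /= !pi_alpha.
- rewrite pi_f !s_f // ordSK Spred !ordS_eq.
  by do 2?[case: ifP => _]; rewrite ?rmorphN ?rmorphD /= ?rmorphN /= ?fmorph_div /= ?pi_alpha ?pi_f.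
- rewrite pi_tau !s_tau // ordS_eq ordSK.
  case: ifP => _; last by rewrite pi_tau.
  by rewrite rmorphM fmorph_div rmorphM /= !pi_tau pi_f ord_predK.
Qed.

Local Notation al := (@alpha K l).
Local Notation f := (@f_ K l).
Local Notation k := (k_ K l).
Local Notation beta := (@beta K l).
Local Notation varpi := (@varpi K l).
Local Notation h := (@h_ K l).
Hypothesis charK : [pchar K] =i pred0.

(** * The domino weights *)

Lemma natF_neq0 n : n.+1%:R != 0 :> F.
Proof.
have -> : n.+1%:R = rcst n.+1%:R :> F by rewrite /rcst !rmorph_nat.
by rewrite tofrac_eq0 mpolyC_eq0 ((pcharf0P _).1 charK).
Qed.

Lemma beta_formula p : beta p = \sum_(r : I) (r%:R / l.+1%:R - (p < r)%:R) * al r.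
Proof.
rewrite /beta /varpi -sumrB [RHS](bigD1 ord0) //= mul0r subr0 mul0r add0r.
apply: eq_bigr => r r0; rewrite -mulrBl; congr (_ * _).
have N0 := natF_neq0 l; have rl := ltn_ord r; have pl := ltn_ord p.
have [pE|pE] := eqVneq (p : nat) l.
  rewrite pE modnn min0n mul0n mul0r !subr0 ltnNge -ltnS rl subr0.
  rewrite (minn_idPr _) -1?ltnS // natrM.
  have -> : l%:R = l.+1%:R - 1 :> F by rewrite -natr1 addrK.
  by rewrite mulrBl mulrBl mul1r (mulrAC l.+1%:R) divff // mul1r; ring.
have pl' : (p < l)%N by rewrite ltn_neqAle pE -ltnS.
rewrite modn_small ?ltnS //.
have [pr|rp] := ltnP p r.
  by rewrite (minn_idPl pr) mulSn natrD -[p.+1%:R]natr1 mulr1n; ring.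
by rewrite (minn_idPr (leqW rp)) mulSn natrD mulr0n; ring.
Qed.

Lemma val_ord_pred (p : I) : p != ord0 -> ord_pred p = p.-1 :> nat.
Proof.
by case: p => -[|p] pl //= _; rewrite modnDr modn_small // ltnW.
Qed.

Lemma beta_diff p : p != ord0 -> beta p - beta (ord_pred p) = al p.
Proof.
move=> p0; have p_gt0 : (0 < p)%N by rewrite lt0n.
rewrite !beta_formula val_ord_pred // -sumrB (bigD1 p) //= big1 => [|r rp].
  rewrite addr0 -mulrBl ltnn prednK // leqnn.
  by rewrite subr0 opprB addrCA subrr addr0 mul1r.
rewrite -mulrBl prednK // [(p <= r)%N]leq_eqVlt.
by rewrite -val_eqE /= eq_sym in rp; rewrite (negbTE rp) subrr mul0r.
Qed.

Lemma beta_sum : \sum_p beta p = 0.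
Proof.
by rewrite /beta sumrB (sum_ordS varpi) subrr.
Qed.

Lemma beta_wrap : beta ord0 - beta (ord_pred ord0) = al ord0 - k.
Proof.
have pl : ord_pred (ord0 : I) = l :> nat by rewrite /= modn_small.
rewrite !beta_formula pl -sumrB /k_ [in RHS](bigD1 ord0) //= opprD addrA subrr sub0r.
rewrite (bigD1 ord0) //= subrr add0r -sumrN; apply: eq_bigr => r r0.
rewrite -mulrBl lt0n r0 [(l < r)%N]ltnNge -ltnS ltn_ord /=; ring.
Qed.

(** Both reflections and the rotation act on [beta] in a way that is visible on
    the differences [beta_diff] and on the sum [beta_sum]; this is how their
    action is computed without expanding [varpi]. *)
Lemma diff_sum_inj (u v : I -> F) :
  (forall p, p != ord0 -> u p - u (ord_pred p) = v p - v (ord_pred p)) ->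
  \sum_p u p = \sum_p v p -> u =1 v.
Proof.
move=> duv suv; pose w p := u p - v p.
have w0 p : w p = w ord0.
  elim/ordS_ind: p => // p IH; have [->//|p0] := eqVneq (ordS p) ord0.
  have := duv _ p0; rewrite ordSK => /eqP; rewrite subr_eq => /eqP e.
  by rewrite -IH /w e; ring.
have : \sum_p w p = 0 by rewrite sumrB suv subrr.
rewrite (eq_bigr (fun=> w ord0)) // sumr_const card_ord -mulr_natl => /eqP.
rewrite mulf_eq0 (negbTE (natF_neq0 l)) /= => /eqP w00 p.
by apply/eqP; rewrite -subr_eq0 -/(w p) w0 w00.
Qed.

(** The reflection acts on the differences [alpha_p] as the exchange of
    [beta i] and [beta (ord_pred i)] does. *)
Lemma s_beta i p : i != ord0 -> s_ i (beta p) =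
  if p == i then beta (ord_pred i) else if p == ord_pred i then beta i else beta p.
Proof.
move=> i0; apply: (diff_sum_inj (u := fun p => s_ i (beta p)) (v := fun p => if p == i
   then beta (ord_pred i) else if p == ord_pred i then beta i else beta p)).
  move=> q q0; rewrite -rmorphB beta_diff //= s_alpha //.
  have Pi := ord_pred_neq l_gt1 i.
  rewrite [ord_pred q == ord_pred i](inj_eq (can_inj (@ord_predK l.+1))).
  have -> : (ord_pred q == i) = (q == ordS i) by rewrite -ordS_eq ord_predK.
  have [->|qi] := eqVneq q i.
    rewrite [i == ordS i]eq_sym (negbTE (ordS_neq l_gt1 i)).
    by rewrite -(beta_diff i0) opprB.
  have [qS|qS] := eqVneq q (ordS i).
    rewrite qS (negbTE (ordS_neq_pred l_gt1 i)) -(beta_diff i0) -qS -(beta_diff q0).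
    by rewrite qS ordSK addrA subrK.
  have [qP|qP] := eqVneq q (ord_pred i); last by rewrite -(beta_diff q0).
  by rewrite -(beta_diff i0) -(beta_diff q0) -qP addrC addrA subrK.
have Pi := ord_pred_neq l_gt1 i.
rewrite -rmorph_sum beta_sum rmorph0 -[LHS]beta_sum.
rewrite [RHS](bigD1 i) // [X in _ = _ + X](bigD1 (ord_pred i)) //= !eqxx (negbTE Pi).
rewrite [LHS](bigD1 i) // [X in _ + X = _](bigD1 (ord_pred i)) //= addrCA.
congr (_ + (_ + _)); apply: eq_bigr => q /andP[qi qp].
by rewrite (negbTE qi) (negbTE qp).
Qed.

(** The rotation shifts [beta] up to two corrections: the difference at node 0 is
    [alpha_0 - k] instead of [alpha_0], and the sum must remain zero. *)
Lemma pi_beta p : rot (beta p) =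
  beta (ordS p) - k / l.+1%:R + k * indic ord0 (ordS p).
Proof.
apply: (diff_sum_inj (u := fun p => rot (beta p))
  (v := fun p => beta (ordS p) - k / l.+1%:R + k * indic ord0 (ordS p))) p.
  move=> q q0; rewrite -rmorphB beta_diff //= pi_alpha ord_predK.
  rewrite /indic (negbTE q0) mulr0 addr0.
  have [qS|qS] := eqVneq (ordS q) ord0; last first.
    by rewrite -(beta_diff qS) ordSK /=; ring.
  have := beta_wrap; rewrite -qS ordSK qS => /eqP; rewrite eq_sym subr_eq => /eqP ->.
  by rewrite mulr1; ring.
rewrite -rmorph_sum beta_sum rmorph0 big_split sumrB /=.
rewrite (sum_ordS beta) beta_sum sumr_const card_ord -mulr_sumr (sum_ordS (indic ord0)).
by rewrite indic_total -[(k / _) *+ _]mulr_natr divfK ?natF_neq0 // mulr1 sub0r addNr.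
Qed.

Let two_neq0 : 2%:R != 0 :> F := natF_neq0 1.

(** * The Hamiltonians *)

Lemma calS_sum_chi d : (0 < d)%N ->
  \sum_(A in calS l d) chi K (~: A) * Defs.fprod K A
  = \sum_(A in calS l d) fmono f A * \sum_(p | state_of A p) beta p.
Proof. by move=> d0; apply: eq_bigr => A dA; rewrite (chi_beta K d0 dA) mulrC. Qed.

Lemma h0_even : ~~ odd l -> h0 K l = (dimer_sum f beta)`_3.
Proof. by move=> le; rewrite /h0 (negbTE le) calS_sum_chi // dimer_sum_coef3. Qed.

(** This is the alternating sum of the [varpi i], whose square occurs in [h0];
    in terms of [beta] it is the sum over the odd nodes, and minus the sum over
    the even ones. *)
Definition alt_weight : F := parity_sum al (ordS ord0) / 2%:R.

Lemma sum_even_beta : odd l ->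
  \sum_(p : I | ~~ odd p) beta p = - \sum_(p : I | odd p) beta p.
Proof.
move=> lo; have := beta_sum; rewrite (bigID (fun p : I => odd p)) /=.
by move=> /eqP; rewrite addrC addr_eq0 => /eqP.
Qed.

(** Twice the sum over the odd nodes is the difference of the two parity classes,
    which collects the [beta p - beta (ord_pred p) = alpha_p] for odd [p]. *)
Lemma sum_odd_beta : odd l -> \sum_(p : I | odd p) beta p = alt_weight.
Proof.
move=> lo; set O := LHS; have : O - - O = parity_sum al (ordS ord0).
  rewrite -(sum_even_beta lo) [X in _ - X](reindex_inj (can_inj (@ord_predK l.+1))) /=.
  rewrite -(parity_sum_odd lo) [X in _ - X](eq_bigl (fun p : I => odd p)) => [|p]; last first.
    by rewrite (odd_ord_pred p lo) negbK.
  rewrite /O -sumrB; apply: eq_bigr => p po; apply: beta_diff.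
  by apply: contraTneq po => ->.
by rewrite opprK -mulr2n -[O *+ 2]mulr_natr /alt_weight => <-; rewrite mulfK.
Qed.

Lemma h0_square : odd l ->
  \sum_(i : I | i != ord0) (-1) ^+ i.-1 * varpi i = alt_weight.
Proof.
move=> lo; rewrite -(sum_odd_beta lo) /beta sumrB.
have -> : \sum_(p : I | odd p) varpi (ordS p) = \sum_(p : I | ~~ odd p) varpi p.
  rewrite [RHS](reindex_inj (can_inj (@ordSK l.+1))) /=; apply: eq_bigl => p.
  by rewrite -{1}[p]ordSK (odd_ord_pred _ lo).
have v0 : varpi ord0 = 0.
  by rewrite /Defs.varpi big1 // => r _; rewrite min0n mul0n mul0r subrr mul0r.
rewrite (bigID (fun p : I => odd p)) /= -sumrN; congr (_ + _).
  apply: eq_big => [p|p /andP[p0 po]]; first by rewrite andb_idl // => po; apply: contraTneq po => ->.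
  by rewrite -signr_odd -[odd _]negbK -oddS prednK ?lt0n // po mul1r.
rewrite [RHS](bigD1 (ord0 : I)) //= v0 oppr0 add0r.
apply: eq_big => [p|p /andP[p0 po]]; first by rewrite andbC.
by rewrite -signr_odd -[odd _]negbK -oddS prednK ?lt0n // po expr1 mulN1r.
Qed.

Lemma half_sq_diff_beta : odd l ->
  half_sq_diff (fun i : I => odd i) beta + half_sq_diff (fun i : I => ~~ odd i) beta
  = alt_weight ^+ 2 - (\sum_p beta p ^+ 2) / 2%:R.
Proof.
move=> lo; rewrite /half_sq_diff (sum_even_beta lo) (sum_odd_beta lo) sqrrN.
rewrite [X in _ - X / _](bigID (fun p : I => odd p)) /=.
set S1 := \sum_(p < l.+1 | odd p) _; set S2 := \sum_(p < l.+1 | ~~ odd p) _.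
have e : alt_weight ^+ 2 = (alt_weight ^+ 2 + alt_weight ^+ 2) / 2%:R.
  by rewrite -mulr2n -[(alt_weight ^+ 2) *+ 2]mulr_natr mulfK.
rewrite [in RHS]e; ring.
Qed.

(** The two states without monomers contribute [alt_weight ^+ 2] up to the
    symmetric sum of squares, which is added back. *)
Lemma h0_odd : odd l -> h0 K l = (dimer_sum f beta)`_4 + (\sum_p beta p ^+ 2) / 2%:R.
Proof.
move=> lo; rewrite /h0 lo calS_sum_chi // h0_square // dimer_sum_coef4 //.
by rewrite half_sq_diff_beta // addrA subrK.
Qed.

(** For [i] different from 0 the reflection exchanges the two domino weights at
    node [i] and kicks its neighbours, so it preserves the dimer sum; the
    sum of the squares of the [beta p] is symmetric. *)
Lemma s_h0 i : i != ord0 -> s_ i (h0 K l) = h0 K l.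
Proof.
move=> i0; have fi0 : f i != 0 := rvar_neq0 _ _.
have bi : beta i = beta (ord_pred i) + al i / f i * f i.
  by rewrite divfK // -(beta_diff i0) addrC subrK.
have sZ n : s_ i (dimer_sum f beta)`_n = (dimer_sum f beta)`_n.
  have sfE := fun j => s_f K l_gt1 i j; have sbE := fun p => s_beta p i0.
  have e := etrans (eq_dimer_sum sfE sbE) (dimer_sum_swap l_gt1 two_neq0 bi).
  exact: etrans (dimer_sum_map _ _ _ _) (congr1 (fun q : {poly F} => q`_n) e).
have [lo|le] := boolP (odd l); last by rewrite h0_even // sZ.
rewrite h0_odd // rmorphD fmorph_div rmorph_nat rmorph_sum /= sZ; congr (_ + _ / _).
rewrite [RHS](reindex_inj (@perm_inj _ (tperm i (ord_pred i)))) /=.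
apply: eq_bigr => p _; rewrite rmorphXn /= s_beta //; congr (_ ^+ 2).
case: tpermP => [->|->|/eqP/negbTE-> /eqP/negbTE-> //]; first by rewrite eqxx.
by rewrite (negbTE (ord_pred_neq l_gt1 i)) eqxx.
Qed.

Lemma s_h i j : i != j -> s_ i (h j) = h j.
Proof.
move=> ij; rewrite /h_.
have shift m p x : s_ (sh p m) (iter m rot x) = iter m rot (s_ p x).
  by elim: m => [|m IH] /=; rewrite ?sh0 // -shS s_pi IH.
rewrite -(step_backK i j) shift s_h0 //; apply: contra ij => /eqP b0.
by rewrite -(step_backK i j) b0; apply/eqP/val_inj; rewrite /= add0n modn_small.
Qed.

Lemma pi_monomer1 p : rot (monomer1 f p) = monomer1 f (ordS p).
Proof.
by rewrite rmorph_monomer1 -monomer1_shift; apply: eq_monomer1 => j; rewrite /= pi_f.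
Qed.

Lemma pi_monomer2 p : rot (monomer2 f p) = monomer2 f (ordS p).
Proof.
by rewrite rmorph_monomer2 -monomer2_shift; apply: eq_monomer2 => j; rewrite /= pi_f.
Qed.

Lemma pi_parity_sum_f j : rot (parity_sum f j) = parity_sum f (ordS j).
Proof.
by rewrite rmorph_parity_sum -parity_sum_shift; apply: eq_parity_sum => i; rewrite /= pi_f.
Qed.

Lemma pi_parity_sum_al j : rot (parity_sum al j) = parity_sum al (ordS j).
Proof.
by rewrite rmorph_parity_sum -parity_sum_shift; apply: eq_parity_sum => i; rewrite /= pi_alpha.
Qed.

Lemma pi_dimer_sum0 n : rot (dimer_sum f (fun=> 0))`_n = (dimer_sum f (fun=> 0))`_n.
Proof.
have p0 (j : I) : rot 0 = 0 := rmorph0 _.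
have e := etrans (eq_dimer_sum (@pi_f K l) p0) (dimer_sum_rot f (fun=> 0)).
exact: etrans (dimer_sum_map _ _ _ _) (congr1 (fun q : {poly F} => q`_n) e).
Qed.

(** Only the two corrections of [pi_beta] survive in the difference. *)
Lemma pi_linear (u : I -> F) : (forall p, rot (u p) = u (ordS p)) ->
  rot (\sum_p beta p * u p) - \sum_p beta p * u p
  = k * u ord0 - k / l.+1%:R * \sum_p u p.
Proof.
move=> uE; rewrite rmorph_sum /=.
rewrite (eq_bigr (fun p => (fun q => (beta q - k / l.+1%:R + k * indic ord0 q) * u q) (ordS p))).
  rewrite (sum_ordS (fun q => (beta q - k / l.+1%:R + k * indic ord0 q) * u q)).
  have -> : k * u ord0 = \sum_q k * indic ord0 q * u q.
    rewrite (bigD1 ord0) //= big1 => [|q /negbTE q0]; last by rewrite /indic q0 mulr0 mul0r.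
    by rewrite /indic eqxx mulr1 addr0.
  rewrite mulr_sumr -!sumrB; apply: eq_bigr => q _; ring.
by move=> p _; rewrite rmorphM /= pi_beta uE.
Qed.

Lemma pi_sum (u : I -> F) : (forall p, rot (u p) = u (ordS p)) ->
  rot (\sum_p u p) = \sum_p u p.
Proof. by move=> uE; rewrite rmorph_sum -(sum_ordS u); apply: eq_bigr => p _ /=. Qed.

(** The second term is the same for all [j] and drops out of second differences. *)
Lemma h_step_even j : ~~ odd l ->
  h (ordS j) - h j = k * monomer1 f j - k / l.+1%:R * \sum_p monomer1 f p.
Proof.
move=> le; elim/ordS_ind: j => [|j IH].
  rewrite h_succ /h_ /= h0_even // dimer_sum_linear3 // rmorphD /= pi_dimer_sum0.
  by rewrite opprD addrACA subrr add0r pi_linear //; apply: pi_monomer1.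
rewrite !h_succ -rmorphB -h_succ IH rmorphB !rmorphM fmorphV rmorph_nat /= pi_k.
by rewrite pi_monomer1 (pi_sum pi_monomer1).
Qed.

(** At [j = 0] the square of [alt_weight] accounts for the last term, as the
    rotation maps [alt_weight] to [k / 2 - alt_weight]. *)
Lemma h_step_odd j : odd l ->
  h (ordS j) - h j = k * monomer2 f j - k / l.+1%:R * \sum_p monomer2 f p
    + (k ^+ 2 / 4%:R - k / 2%:R * parity_sum al (ordS j)).
Proof.
move=> lo; elim/ordS_ind: j => [|j IH].
  have h0E : h0 K l = (dimer_sum f (fun=> 0))`_4 + \sum_p beta p * monomer2 f p
      + alt_weight ^+ 2.
    rewrite (h0_odd lo) [X in X + _ = _](dimer_sum_linear4 two_neq0 f beta lo).
    by rewrite (half_sq_diff_beta lo) addrA subrK.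
  have piB : rot alt_weight = k / 2%:R - alt_weight.
    rewrite /alt_weight fmorph_div rmorph_nat /= pi_parity_sum_al parity_sum_period //.
    by rewrite /Defs.k_ -(parity_sum_total lo _ ord0) mulrDl addrK.
  rewrite h_succ /h_ /= h0E !rmorphD /= pi_dimer_sum0 rmorphXn /= piB.
  have := pi_linear pi_monomer2; rewrite -/(rot _).
  set X := rot _; set Y := \sum_p beta p * _ => e.
  transitivity (X - Y + ((k / 2%:R - alt_weight) ^+ 2 - alt_weight ^+ 2)); first by ring.
  rewrite e; congr (_ + _); rewrite /alt_weight.
  exact: shifted_square.
rewrite !h_succ -rmorphB -h_succ IH rmorphD !rmorphB !rmorphM !fmorphV !rmorph_nat /=.
by rewrite pi_k pi_monomer2 (pi_sum pi_monomer2) pi_parity_sum_al.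
Qed.

(** * The flow of the variables f *)

(** With these two quantities the derivation reads
    [f_j' = f_j * flow_rate j + alpha_j * alpha_coef j] for both parities of [l],
    so that commutation with the reflections is proved for both at once. *)
Definition alpha_coef j : F := if odd l then parity_sum f j else 1.

Definition flow_rate j : F :=
  if odd l then monomer2 f (ord_pred j) - monomer2 f j + (k / 2%:R - parity_sum al j)
  else monomer1 f (ord_pred j) - monomer1 f j.

Lemma h_second_diff j : k * flow_rate j = 2%:R * h j - h (ord_pred j) - h (ordS j).
Proof.
have -> : 2%:R * h j - h (ord_pred j) - h (ordS j)
    = (h (ordS (ord_pred j)) - h (ord_pred j)) - (h (ordS j) - h j).
  by rewrite ord_predK; ring.
rewrite /flow_rate; have [lo|le] := boolP (odd l).
  rewrite !h_step_odd // ord_predK; apply: second_diff_identity => //.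
  by rewrite /Defs.k_ -(parity_sum_total lo al j) addrC addKr.
by rewrite !h_step_even //; ring.
Qed.

Lemma f_derE j : f_der K j = f j * flow_rate j + al j * alpha_coef j.
Proof.
have shift_idx (u : I -> F) r : (0 < r)%N -> u (sh j (2 * r - 1)) = u (sh (ord_pred j) (2 * r)).
  by move=> r0; rewrite -[in LHS]sh_pred; congr (u (sh _ _)); lia.
rewrite /f_der /flow_rate /alpha_coef; have [lo|le] := boolP (odd l); last first.
  rewrite mulr1; congr (_ * (_ - _) + _).
  by apply: eq_big_nat => r /andP[r0 _]; rewrite shift_idx.
rewrite (parity_sum_recl f) (parity_sum_recl al).
have -> : \sum_(1 <= s < l./2.+1) \sum_(1 <= r < s.+1)
      f (sh j (2 * r - 1)) * f (sh j (2 * s)) = monomer2 f (ord_pred j).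
  apply: eq_big_nat => s _; apply: eq_big_nat => r /andP[r0 _].
  by rewrite shift_idx // addn1 sh_pred.
by rewrite -/(monomer2 f j); ring.
Qed.

Lemma flow_rate_step j :
  flow_rate j + flow_rate (ordS j) = f (ordS j) * alpha_coef j - f j * alpha_coef (ordS j).
Proof.
rewrite /flow_rate /alpha_coef ordSK; have [lo|le] := boolP (odd l).
  rewrite -monomer2_step //; apply: step_identity => //.
  exact: parity_sum_total.
by rewrite !mulr1 -monomer1_step //; ring.
Qed.

Lemma s_f_kick i : s_ i \o f =1 kick (al i / f i) i f.
Proof. exact: s_f_indic. Qed.

Lemma s_parity_sum_al i : odd l -> s_ i (parity_sum al i) = parity_sum al i - 2%:R * al i.
Proof.
move=> lo; rewrite rmorph_parity_sum.
rewrite (eq_parity_sum (v := fun j => al j + al i * (indic (ordS i) j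
   + (indic (ord_pred i) j + - 2%:R * indic i j)))); last first.
  by move=> j; rewrite /= s_alpha_indic; ring.
rewrite !(parity_sumD, parity_sumZ) -parity_sum_indic_next // parity_sum_indic_succ //.
by rewrite parity_sum_indic //; ring.
Qed.

Lemma s_alpha_coef i j : s_ i (alpha_coef j) = alpha_coef j.
Proof.
rewrite /alpha_coef; case: ifP => lo; last by rewrite rmorph1.
rewrite rmorph_parity_sum (eq_parity_sum (v := fun m => f m + al i / f i * (indic (ordS i) m
   + -1 * indic (ord_pred i) m))); last first.
  by move=> m; rewrite /= s_f_indic mulN1r.
by rewrite !(parity_sumD, parity_sumZ) parity_sum_indic_next // mulN1r subrr mulr0 addr0.
Qed.

(** Two contributions: the kick of the neighbours of [i] and, for odd [l], the
    change of the sum of the [alpha] in the class of [i]. *)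
Lemma s_flow_rate i : s_ i (flow_rate i) = flow_rate i + 2%:R * (al i / f i) * alpha_coef i.
Proof.
have fi0 : f i != 0 := rvar_neq0 _ _.
rewrite /flow_rate /alpha_coef; have [lo|le] := boolP (odd l).
  rewrite rmorphD !rmorphB fmorph_div rmorph_nat /= s_k s_parity_sum_al //.
  rewrite !rmorph_monomer2 !(eq_monomer2 _ (s_f_kick i)) monomer2_kick //.
  exact: kick_identity.
rewrite rmorphB /= !rmorph_monomer1 !(eq_monomer1 _ (s_f_kick i)) monomer1_kick //.
by rewrite mulr1.
Qed.

Lemma s_h_succ i : s_ i (h (ordS i)) = h (ordS i).
Proof. by apply: s_h; rewrite eq_sym ordS_neq. Qed.

Lemma s_h_pred i : s_ i (h (ord_pred i)) = h (ord_pred i).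
Proof. by apply: s_h; rewrite eq_sym ord_pred_neq. Qed.

(** In [2 h_i = k * flow_rate i + h_(i-1) + h_(i+1)] the reflection fixes the
    neighbouring Hamiltonians and acts on [flow_rate i] by [s_flow_rate]. *)
Lemma s_h_diag i : s_ i (h i) = h i + k * (al i / f i * alpha_coef i).
Proof.
have := congr1 (s_ i) (h_second_diff i).
rewrite !rmorphB !rmorphM rmorph_nat /= s_k s_flow_rate s_h_succ s_h_pred.
exact: diag_identity two_neq0 (h_second_diff i).
Qed.

(** Among the Hamiltonians in the second difference at [i+1], only [h_i] moves. *)
Lemma s_flow_rate_succ i :
  s_ i (flow_rate (ordS i)) = flow_rate (ordS i) - al i / f i * alpha_coef i.
Proof.
have := congr1 (s_ i) (h_second_diff (ordS i)).
rewrite !rmorphB !rmorphM rmorph_nat /= s_k ordSK s_h_diag s_h_succ s_h; last first.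
  by have := pred2_neq l_gt1 (ordS (ordS i)); rewrite !ordSK.
have := h_second_diff (ordS i); rewrite ordSK.
exact: neighbour_identity (k_neq0 K l).
Qed.

Lemma s_flow_rate_pred i :
  s_ i (flow_rate (ord_pred i)) = flow_rate (ord_pred i) - al i / f i * alpha_coef i.
Proof.
have := congr1 (s_ i) (h_second_diff (ord_pred i)).
rewrite !rmorphB !rmorphM rmorph_nat /= s_k ord_predK s_h_diag s_h_pred s_h; last first.
  by rewrite eq_sym pred2_neq.
have := h_second_diff (ord_pred i); rewrite ord_predK ![_ - _ - h i]addrAC.
rewrite [_ - _ - (h i + _)]addrAC.
exact: neighbour_identity (k_neq0 K l).
Qed.

Lemma s_flow_rate_far i j : j != i -> j != ordS i -> j != ord_pred i ->
  s_ i (flow_rate j) = flow_rate j.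
Proof.
move=> ji jS jP; apply: (mulfI (k_neq0 K l)).
rewrite -[X in X * _ = _](s_k i) -[LHS]rmorphM /= !h_second_diff.
rewrite !rmorphB rmorphM rmorph_nat /= !s_h //; rewrite eq_sym //.
- by apply: contra jP => /eqP <-; rewrite ordSK.
- by apply: contra jS => /eqP <-; rewrite ord_predK.
Qed.

Lemma pi_alpha_coef j : rot (alpha_coef j) = alpha_coef (ordS j).
Proof. by rewrite /alpha_coef; case: ifP => _; rewrite ?pi_parity_sum_f ?rmorph1. Qed.

Lemma pi_flow_rate j : rot (flow_rate j) = flow_rate (ordS j).
Proof.
apply: (mulfI (k_neq0 K l)); rewrite -[X in X * _ = _]pi_k -[LHS]rmorphM /= !h_second_diff.
rewrite !rmorphB rmorphM rmorph_nat /= -!h_succ ordSK.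
by rewrite ord_predK.
Qed.

(** * Commutation with the derivation *)

Lemma f_neq0 i : f i != 0.
Proof. exact: rvar_neq0. Qed.

Lemma der_f_flow j : der (f j) = f j * flow_rate j + al j * alpha_coef j.
Proof. by rewrite der_f f_derE. Qed.

Lemma der_tauE j : der (tau K j) = h j * tau K j / k.
Proof. by rewrite -der_tau mulrC mulKf ?k_neq0. Qed.

Lemma der_al_div_f i :
  der (al i / f i) = - (al i * (f i * flow_rate i + al i * alpha_coef i) / f i ^+ 2).
Proof.
rewrite der_mul der_alpha mul0r add0r (derivation_inv (@der_mul K l) (f_neq0 i)) der_f_flow.
by rewrite mulNr mulrN mulrA.
Qed.

(** When [j] is a neighbour of [i], the difference of the two sides is a multiple
    of the difference of the two sides of [flow_rate_step]. *)
Lemma s_der_f i j : s_ i (der (f j)) = der (s_ i (f j)).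
Proof.
have fi0 := f_neq0 i.
rewrite der_f_flow rmorphD !rmorphM /= s_alpha_coef s_f // s_alpha //.
have [->|ji] := eqVneq j i.
  rewrite [i == ordS i]eq_sym [i == ord_pred i]eq_sym.
  rewrite (negbTE (ordS_neq l_gt1 i)) (negbTE (ord_pred_neq l_gt1 i)) s_flow_rate der_f_flow.
  exact: reflect_self_identity.
have [->|jS] := eqVneq j (ordS i).
  rewrite /= s_flow_rate_succ der_add der_f_flow der_al_div_f.
  by apply: reflect_succ_identity => //; exact: flow_rate_step.
have [->|jP] := eqVneq j (ord_pred i).
  rewrite /= s_flow_rate_pred der_add (derivation_opp (@der_add K l)) der_f_flow der_al_div_f.
  apply: reflect_pred_identity => //.
  by have := flow_rate_step (ord_pred i); rewrite ord_predK.
by rewrite s_flow_rate_far // der_f_flow.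
Qed.

(** For [j = i] the logarithmic derivative of the product defining [s_i tau_i]
    is [(h_(i-1) + h_(i+1) - h_i) / k + f_i' / f_i], and this is [s_i h_i / k]. *)
Lemma s_der_tau i j : s_ i (der (tau K j)) = der (s_ i (tau K j)).
Proof.
have t0 (p : I) : tau K p != 0 := rvar_neq0 _ _.
rewrite der_tauE !rmorphM fmorphV /= s_k s_tau //; have [->|ji] := eqVneq j i.
  rewrite s_h_diag !der_mul (derivation_inv (@der_mul K l) (t0 i)) !der_tauE der_f_flow.
  by apply: reflect_tau_identity; [exact: f_neq0|exact: t0|exact: k_neq0|exact: h_second_diff].
by rewrite s_h 1?eq_sym // der_tauE.
Qed.

Lemma s_der i x : s_ i (der x) = der (s_ i x).
Proof.
apply: (der_commute (g := s_ i)) => [c|j|j|j]; first exact: s_cst.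
- rewrite der_alpha rmorph0 /= s_alpha //; do 2?[case: ifP => _];
    by rewrite ?(derivation_opp (@der_add K l)) ?der_add !der_alpha ?oppr0 ?addr0.
- exact: s_der_f.
- exact: s_der_tau.
Qed.

Lemma pi_der x : rot (der x) = der (rot x).
Proof.
apply: (der_commute (g := rot)) => [c|j|j|j]; first exact: pi_cst.
- by rewrite der_alpha rmorph0 /= pi_alpha der_alpha.
- by rewrite /= pi_f !der_f_flow rmorphD !rmorphM /= pi_f pi_flow_rate pi_alpha pi_alpha_coef.
- by rewrite /= pi_tau !der_tauE !rmorphM fmorphV /= pi_tau pi_k h_succ.
Qed.

Lemma weyl_der w : weyl w -> forall x : F, w (der x) = der (w x).
Proof.
elim=> [i|||w1 w2 _ IH1 _ IH2|w1 w2 _ IH w12 w21] x //=; first exact: s_der.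
- exact: pi_der.
- by rewrite IH2 IH1.
by rewrite -{1}[x]w21 -IH w12.
Qed.
End Reflection.
End Generators.

From mathcomp Require Import reals complex.
Local Open Scope complex_scope.

Theorem theorem4p9 (R : realType) (l : nat) (hl : (2 <= l)%N)
    (w : ratfun R[i] l -> ratfun R[i] l) (hw : weyl w) (phi : ratfun R[i] l) :
  w (der phi) = der (w phi).
Proof. exact: weyl_der hl (@pchar_num R[i]) _ hw phi. Qed.
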